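(* Let $\mathbf A\in\mathbb R^{n\times n}$. The following are equivalent: (1) both $\mathbf A$ and $\mathbf A^T$ have the Gantmacher--Krein property; (2) for every $j=1,\dots,n$, both $\mathbf A^{(j)}$ and $(\mathbf A^{(j)})^T$ have the strong Perron--Frobenius property; (3) for every $j=1,\dots,n$, $\mathbf A^{(j)}$ is eventually positive; (4) $\mathbf A$ is eventually strictly totally positive.
   Context: The $j$th compound matrix $\mathbf A^{(j)}$ is the $\binom nj\times\binom nj$ matrix of all $j\times j$ minors of $\mathbf A$ with row and column index sets in lexicographic order. A square matrix has the strong Perron--Frobenius property if it has a simple positive eigenvalue strictly larger in absolute value than all other eigenvalues, with a corresponding eigenvector having all coordinates positive. A matrix $\mathbf B$ is eventually positive if there is $k_0$ with $\mathbf B^k$ entrywise positive for all $k\ge k_0$. $\mathbf A$ is strictly totally positive (STP) if all its minors of all orders are positive, and eventually strictly totally positive (ESTP) if there is $k_0$ with $\mathbf A^k$ STP for all $k\ge k_0$. For $x\in\mathbb R^n$, $S^+(x)$ is the maximal number of sign changes in $(x^1,\dots,x^n)$ when zero coordinates are assigned values $\pm1$ arbitrarily. Nonzero vectors $x_1,\dots,x_n$ form a Markov system if $S^+(\sum_{i=1}^j c_ix_i)\le j-1$ for every $1\le j\le n$ and all real $c_i$ not all zero. $\mathbf A$ has the Gantmacher--Krein property if it has $n$ positive simple eigenvalues $\lambda_1>\dots>\lambda_n>0$ whose corresponding eigenvectors $x_1,\dots,x_n$ (in this order) form a Markov system. *)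

(* Defs.v *)
From HB Require Import structures.
From mathcomp Require Import all_boot all_order all_algebra.
From mathcomp Require Import reals.
From mathcomp.real_closed Require Import complex.
Set Implicit Arguments. Unset Strict Implicit. Unset Printing Implicit Defensive.
Import Order.TTheory GRing.Theory Num.Theory.
Local Open Scope ring_scope.

(* [combs j s] lists the j-element subsequences of s; when s is increasing
   (e.g. s = enum 'I_n) these are the j-subsets, each listed increasingly,
   in lexicographic order. *)
Fixpoint combs (T : Type) (j : nat) (s : seq T) : seq (seq T) :=
  match j, s with
  | 0, _ => [:: [::]]
  | _.+1, [::] => [::]
  | j'.+1, x :: s' => map (cons x) (combs j' s') ++ combs j s'
  end.

Definition subsets_lex (n j : nat) : seq (seq 'I_n) := combs j (enum 'I_n).

Definition minor (R : comNzRingType) (n j : nat) (A : 'M[R]_n)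
  (r c : seq 'I_n) : R :=
  \det (\matrix_(a < j, b < j)
          match nth None (map Some r) a, nth None (map Some c) b with
          | Some i, Some k => A i k
          | _, _ => 0
          end).

Definition compound (R : comNzRingType) (n j : nat) (A : 'M[R]_n) :
  'M[R]_(size (subsets_lex n j)) :=
  \matrix_(p, q) minor j A (nth [::] (subsets_lex n j) p)
                           (nth [::] (subsets_lex n j) q).

Definition simple_eigenvalue (R : realType) (m : nat) (B : 'M[R]_m) (l : R) :=
  ('X - l%:P) %| char_poly B /\ ~ (('X - l%:P) ^+ 2 %| char_poly B).

Definition ceigenvalue (R : realType) (m : nat) (B : 'M[R]_m) (z : complex R) :=
  root (map_poly (fun x : R => (x%:C)%C) (char_poly B)) z.

Definition strong_PF (R : realType) (m : nat) (B : 'M[R]_m) : Prop :=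
  exists l : R,
    [/\ 0 < l, simple_eigenvalue B l,
        (forall z : complex R, ceigenvalue B z -> z != (l%:C)%C -> `|z| < (l%:C)%C) &
        exists v : 'cV[R]_m, (forall i, 0 < v i ord0) /\ B *m v = l *: v].

Definition eventually_positive (R : realType) (m : nat) (B : 'M[R]_m) : Prop :=
  exists k0 : nat, forall k : nat, (k0 <= k)%N -> forall i j, 0 < (B ^+ k) i j.

Definition STP (R : realType) (n : nat) (A : 'M[R]_n) : Prop :=
  forall j : nat, (1 <= j <= n)%N ->
    forall r c, r \in subsets_lex n j -> c \in subsets_lex n j ->
      0 < minor j A r c.

Definition ESTP (R : realType) (n : nat) (A : 'M[R]_n) : Prop :=
  exists k0 : nat, forall k : nat, (k0 <= k)%N -> STP (A ^+ k).

Definition sign_changes (R : realType) (s : seq R) : nat :=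
  count (fun p : R * R => p.1 * p.2 < 0) (zip s (behead s)).

Definition Splus (R : realType) (n : nat) (x : 'cV[R]_n) : nat :=
  \max_(e : {ffun 'I_n -> bool})
     sign_changes [seq (if x i ord0 == 0%R then (if e i then 1%R else (-1)%R) else x i ord0)
                  | i <- enum 'I_n].

(* x_0, ..., x_(n-1) (i.e. x_1..x_n of the paper) form a Markov system *)
Definition markov_system (R : realType) (n : nat) (x : 'I_n -> 'cV[R]_n) : Prop :=
  (forall i, x i != 0) /\
  forall j : nat, (1 <= j <= n)%N ->
    forall c : 'I_n -> R, (exists i : 'I_n, (i < j)%N /\ c i != 0) ->
      (Splus (\sum_(i < n | (i < j)%N) c i *: x i) <= j.-1)%N.

Definition gantmacher_krein (R : realType) (n : nat) (A : 'M[R]_n) : Prop :=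
  exists (l : 'I_n -> R) (x : 'I_n -> 'cV[R]_n),
    [/\ forall i, 0 < l i,
        forall i k : 'I_n, (i < k)%N -> l k < l i,
        forall i, simple_eigenvalue A (l i),
        forall i, A *m x i = l i *: x i &
        markov_system x].

(* Main.v *)
(* All eigenvalue information is read off the compounds.  If P A = T P with T
   triangular, then the j-th compound of T is triangular for the order by sum of
   indices, so the eigenvalues of the j-th compound of A are the products of j
   eigenvalues of A; and Cauchy-Binet makes compounds multiplicative, so A^k is
   STP iff the k-th powers of all compounds are positive.

   (1) => (2): for a basis X of eigenvectors the Markov condition says exactly
   that the minors of the first j columns of X have one strict sign, i.e. that
   the top eigenvector of the j-th compound is positive up to a scalar.  This
   rests on the relation sum_a (-1)^a y_(i_a) M_a = 0 between the coordinates of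
   a vector y of the span and the maximal minors M_a of j + 1 rows i_0 < ... < i_j.

   (2) <=> (3), the Perron-Frobenius theorem for eventually positive matrices:
   deflating B by its dominant rank one part l v w leaves a matrix of smaller
   spectral radius, so B^k is asymptotic to l^k v w > 0.  Conversely, if z is an
   eigenvalue of maximal modulus with eigenvector x, then B^k |x| >= |z|^k |x|,
   and a strict inequality would contradict the growth rate of B^k; hence |x| is
   a positive eigenvector and x has constant phase.

   (4) => (1): the Perron roots of the compounds are the partial products of the
   eigenvalues of A in order of decreasing modulus, which makes these eigenvalues
   positive and distinct. *)

Require Import Defs.
From HB Require Import structures.
From mathcomp Require Import all_boot all_order all_fingroup all_algebra.
From mathcomp Require Import spectral reals ring lra.
From mathcomp.real_closed Require Import complex.
Import Order.TTheory GRing.Theory Num.Theory.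
Local Open Scope ring_scope.

Set Implicit Arguments.
Unset Strict Implicit.
Unset Printing Implicit Defensive.

(** * Index sets as increasing maps, and their lexicographic enumeration *)

Definition increasing (j n : nat) (f : 'I_j -> 'I_n) : Prop :=
  forall a b : 'I_j, (a < b)%N -> (f a < f b)%N.

Lemma increasing_inj (j n : nat) (f : 'I_j -> 'I_n) :
  increasing f -> injective f.
Proof.
move=> incf a b eqf; apply: val_inj; case: (ltngtP a b) => // /incf;
  by rewrite eqf ltnn.
Qed.

Lemma mem_combs (T : eqType) (j : nat) (s t : seq T) :
  (t \in combs j s) = (size t == j) && subseq t s.
Proof.
elim: s j t => [|x s IHs] [|j] t.
- by rewrite inE size_eq0; case: t.
- by case: t => //= y t; rewrite andbF.
- by rewrite inE size_eq0; case: t => //=; rewrite sub0seq.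
rewrite /= mem_cat IHs; case: t => [|y t] /=.
  by rewrite orbF; apply/negP => /mapP[].
rewrite eqSS; case: (eqVneq y x) => [->|neq].
  rewrite mem_map; last by move=> ? ? [].
  rewrite IHs; case: (size t == j) => //=.
  by apply/orP/idP => [[//|/(subseq_trans (subseq_cons t x))]|]; [|left].
suff /negPf -> : y :: t \notin map (cons x) (combs j s) by [].
by apply: contra neq => /mapP[u _ [->]].
Qed.

Lemma combs_uniq (T : eqType) (j : nat) (s : seq T) :
  uniq s -> uniq (combs j s).
Proof.
elim: s j => [|x s IHs] [|j] //= /andP[xs us].
rewrite cat_uniq IHs // map_inj_uniq ?IHs //; last by move=> ? ? [].
rewrite andbT /=; apply/hasPn => t; rewrite mem_combs => /andP[_ sts].
apply/negP => /mapP[u _ tE]; move/negP: xs; apply.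
by apply: (mem_subseq sts); rewrite tE mem_head.
Qed.

Lemma enum_ord_sorted n : sorted ltn (map val (enum 'I_n)).
Proof. by rewrite val_enum_ord iota_ltn_sorted. Qed.

(** A strictly sorted list is determined by its members, so such a list is the filter of the
    enumeration by membership in it, hence a subsequence. *)
Lemma mem_subsets_lex (n j : nat) (t : seq 'I_n) :
  (t \in subsets_lex n j) = (size t == j) && sorted ltn (map val t).
Proof.
rewrite mem_combs; congr andb; apply/idP/idP => [sub|sort].
  by apply: subseq_sorted (map_subseq val sub) (enum_ord_sorted n);
    apply: ltn_trans.
have -> : t = [seq x <- enum 'I_n | x \in t].
  apply: (inj_map val_inj).
  apply: (@irr_sorted_eq _ ltn ltn_trans ltnn) => //.
    apply: (subseq_sorted ltn_trans) (enum_ord_sorted n).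
    exact: map_subseq (filter_subseq _ _).
  move=> x; apply/mapP/mapP => -[i it ->]; exists i => //.
    by rewrite mem_filter it mem_enum.
  by move: it; rewrite mem_filter => /andP[].
exact: filter_subseq.
Qed.

(** * Compound matrices *)

Lemma size_nth_subsets (n j : nat) (p : 'I_(size (subsets_lex n j))) :
  size (nth [::] (subsets_lex n j) p) == j.
Proof.
by have := mem_nth [::] (ltn_ord p); rewrite mem_subsets_lex => /andP[].
Qed.

(** With an index set read as a map, minors become determinants of [mxsub], free of the default
    values hidden in [minor]. *)
Definition idx (n j : nat) (p : 'I_(size (subsets_lex n j))) : 'I_j -> 'I_n :=
  tnth (Tuple (size_nth_subsets p)).

Lemma map_idx (n j : nat) (p : 'I_(size (subsets_lex n j))) :
  [seq idx p a | a <- enum 'I_j] = nth [::] (subsets_lex n j) p.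
Proof. by rewrite map_tnth_enum. Qed.

Lemma sorted_map_ord (n j : nat) (f : 'I_j -> 'I_n) :
  sorted ltn (map val (map f (enum 'I_j))) <-> increasing f.
Proof.
pose g := fun a : 'I_j => val (f a).
rewrite -map_comp; split=> [srt a b ab|inc].
  have szE : size (map g (enum 'I_j)) = j by rewrite size_map size_enum_ord.
  have nthE (c : 'I_j) : nth 0%N (map g (enum 'I_j)) c = f c.
    by rewrite (nth_map c) ?size_enum_ord ?nth_ord_enum.
  rewrite -!nthE; apply: (sorted_ltn_nth ltn_trans) srt _ _ _ _ _ => //;
  by rewrite inE szE.
rewrite sorted_map; have := enum_ord_sorted j; rewrite sorted_map.
by apply: sub_sorted => a b; apply: inc.
Qed.

Lemma idx_increasing (n j : nat) (p : 'I_(size (subsets_lex n j))) :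
  increasing (idx p).
Proof.
apply/sorted_map_ord; rewrite map_idx.
by have := mem_nth [::] (ltn_ord p); rewrite mem_subsets_lex => /andP[].
Qed.

Lemma idx_inj (n j : nat) (p q : 'I_(size (subsets_lex n j))) :
  idx p =1 idx q -> p = q.
Proof.
move=> /eq_map/(_ (enum 'I_j)); rewrite !map_idx => /eqP.
by rewrite nth_uniq ?combs_uniq ?enum_uniq // => /eqP/val_inj.
Qed.

(** The two lists have the same members, and strictly sorted lists with the same members
    coincide. *)
Lemma idx_perm_inj (n j : nat) (p q : 'I_(size (subsets_lex n j))) (s : 'S_j) :
  (forall i, idx p (s i) = idx q i) -> p = q.
Proof.
move=> ext; have uq r : uniq (map (@idx n j r) (enum 'I_j)).
  by rewrite map_inj_uniq ?enum_uniq //; apply/increasing_inj/idx_increasing.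
have codE : perm_eq (map (idx p) (enum 'I_j)) (map (idx q) (enum 'I_j)).
  apply: uniq_perm => // x; apply/mapP/mapP => -[a _ ->].
    by exists (s^-1 a)%g; rewrite ?mem_enum // -ext permKV.
  by exists (s a); rewrite ?mem_enum.
apply: idx_inj => a; suff /eq_in_map -> : map (idx p) (enum 'I_j) =
  map (idx q) (enum 'I_j) by rewrite ?mem_enum.
apply: (inj_map val_inj); apply: (@irr_sorted_eq _ ltn ltn_trans ltnn);
  try by apply/sorted_map_ord/idx_increasing.
by move=> x; apply: perm_mem; apply: perm_map.
Qed.

Lemma increasing_idx (n j : nat) (f : 'I_j -> 'I_n) :
  increasing f -> exists p, idx p =1 f.
Proof.
move=> incf; have fL : map f (enum 'I_j) \in subsets_lex n j.
  by rewrite mem_subsets_lex size_map size_enum_ord eqxx; apply/sorted_map_ord.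
have ltp := fL; rewrite -index_mem in ltp.
exists (Ordinal ltp) => a; have := map_idx (Ordinal ltp).
rewrite [RHS]nth_index // => /eq_in_map -> //; exact: mem_enum.
Qed.

Lemma minor_mxsub (K : comNzRingType) (n j : nat) (A : 'M[K]_n)
    (f g : 'I_j -> 'I_n) :
  minor j A (map f (enum 'I_j)) (map g (enum 'I_j)) = \det (mxsub f g A).
Proof.
have nthE (h : 'I_j -> 'I_n) (a : 'I_j) :
    nth None (map Some (map h (enum 'I_j))) a = Some (h a).
  by rewrite -map_comp (nth_map a) ?size_enum_ord //= nth_ord_enum.
by congr (\det _); apply/matrixP => a b; rewrite !mxE !nthE.
Qed.

Lemma compoundE (K : comNzRingType) (n j : nat) (A : 'M[K]_n) p q :
  compound j A p q = \det (mxsub (idx p) (idx q) A).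
Proof. by rewrite mxE -!map_idx minor_mxsub. Qed.

(** Sorting the values of [f] yields the index set; [s] records the position of each value in the
    sorted list. *)
Lemma inj_idx_perm (n j : nat) (f : 'I_j -> 'I_n) : injective f ->
  exists p, exists s : 'S_j, forall i, f i = idx p (s i).
Proof.
move=> injf; pose t := [tuple f i | i < j].
have szt : size (sort (relpre val leq) t) == j by rewrite size_sort size_tuple.
pose u : j.-tuple 'I_n := Tuple szt.
have [p pE] : exists p, idx p =1 tnth u.
  apply: increasing_idx; apply/sorted_map_ord.
  rewrite map_tnth_enum /= ltn_sorted_uniq_leq map_inj_uniq; last exact: val_inj.
  rewrite sort_uniq sorted_map sort_sorted ?andbT; last first.
    by move=> a b; apply: leq_total.
  by rewrite map_inj_uniq ?enum_uniq.
have /tuple_permP [s sE] : perm_eq t u by rewrite perm_sym perm_sort.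
exists p, s => i; rewrite pE -[LHS](tnth_mktuple f).
have -> : [tuple f i | i < j] = [tuple tnth u (s i) | i < j] by apply: val_inj.
by rewrite tnth_mktuple.
Qed.

(* Injective functions factor uniquely as an increasing one after a permutation. *)
Lemma cauchy_binet (K : comNzRingType) (n j : nat)
    (A : 'M[K]_(j, n)) (B : 'M[K]_(n, j)) :
  \det (A *m B) = \sum_p \det (colsub (@idx n j p) A) * \det (rowsub (idx p) B).
Proof.
(* [F f] collects the terms of the multilinear expansion in which row i passes through the
   intermediate index [f i]. *)
pose F (f : {ffun 'I_j -> 'I_n}) := (\prod_i A i (f i)) * \det (rowsub f B).
have -> : \det (A *m B) = \sum_f F f.
  pose AB (s : 'S_j) i k := A i k * B k (s i).
  transitivity (\sum_(f : {ffun 'I_j -> 'I_n}) \sum_(s : 'S_j)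
                  (-1) ^+ s * \prod_i AB s i (f i)).
    rewrite exchange_big; apply: eq_bigr => /= s _; rewrite -big_distrr /=.
    congr (_ * _); rewrite -(bigA_distr_bigA (AB s)) /=.
    by apply: eq_bigr => x _; rewrite mxE.
  apply: eq_bigr => f _; rewrite /F /determinant mulr_sumr.
  apply: eq_bigr => s _; rewrite big_split /= mulrCA; congr (_ * (_ * _)).
  by apply: eq_bigr => i _; rewrite mxE.
(* A map that is not injective repeats a row of [B], so its term vanishes. *)
rewrite (bigID (fun f : {ffun 'I_j -> 'I_n} => injectiveb f)) /= addrC big1 ?add0r; last first.
  move=> f /injectivePn[a [b neq_ab eqf]]; rewrite /F.
  rewrite (determinant_alternate neq_ab) ?mulr0 // => c.
  by rewrite !mxE eqf.
pose h (x : 'I_(size (subsets_lex n j)) * 'S_j) : {ffun 'I_j -> 'I_n} :=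
  [ffun i => idx x.1 (x.2 i)].
have injh : injective h.
  move=> [p s] [q t] /ffunP eqh.
  have ext i : idx p (s i) = idx q (t i) by have := eqh i; rewrite !ffunE.
  have pq : p = q.
    apply: (@idx_perm_inj n j p q (t^-1 * s)%g) => i.
    by rewrite permM ext permKV.
  rewrite pq in ext *; congr (_, _); apply/permP => i.
  by apply: (increasing_inj (@idx_increasing n j q)); apply: ext.
transitivity (\sum_(f in h @: setT) F f).
  apply: eq_bigl => f; apply/injectiveP/imsetP => [injf|[[p s] _ ->] a b].
    have [p [s fE]] := inj_idx_perm injf.
    by exists (p, s); rewrite ?inE //; apply/ffunP => i; rewrite ffunE.
  by rewrite !ffunE => /(increasing_inj (@idx_increasing n j p))/perm_inj.
rewrite big_imset /=; last by move=> ? ? _ _; apply: injh.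
transitivity (\sum_p \sum_(s : 'S_j) F (h (p, s))).
  by rewrite pair_big /=; apply: eq_big => [x|[p s] _] //; rewrite inE.
apply: eq_bigr => p _; rewrite mulr_suml; apply: eq_bigr => s _.
(* Reordering the rows of the minor of [B] produces the sign of [s], and the sum over [s] then
   rebuilds the minor of [A]. *)
rewrite /F; have -> : rowsub (h (p, s)) B = row_perm s (rowsub (idx p) B).
  by apply/matrixP => a b; rewrite !mxE ffunE.
rewrite row_permE det_mulmx det_perm mulrCA mulrA; congr (_ * _ * _).
by apply: eq_bigr => i _; rewrite !mxE ffunE.
Qed.

Lemma compoundM (K : comNzRingType) (n j : nat) (A B : 'M[K]_n) :
  compound j (A *m B) = compound j A *m compound j B.
Proof.
apply/matrixP => p q; rewrite compoundE mxE.
have -> : mxsub (idx p) (idx q) (A *m B) = rowsub (idx p) A *m colsub (idx q) B.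
  by apply/matrixP => a b; rewrite !mxE; apply: eq_bigr => c _; rewrite !mxE.
rewrite cauchy_binet; apply: eq_bigr => r _; rewrite !compoundE.
by congr (_ * _); congr (\det _); apply/matrixP => a b; rewrite !mxE.
Qed.

Lemma compound_tr (K : comNzRingType) (n j : nat) (A : 'M[K]_n) :
  compound j A^T = (compound j A)^T.
Proof.
apply/matrixP => p q; rewrite [RHS]mxE !compoundE -det_tr.
by congr (\det _); apply/matrixP => a b; rewrite !mxE.
Qed.

Lemma compound_map (K L : comNzRingType) (phi : {rmorphism K -> L}) (n j : nat)
    (A : 'M[K]_n) :
  compound j (map_mx phi A) = map_mx phi (compound j A).
Proof.
apply/matrixP => p q; rewrite [RHS]mxE !compoundE -det_map_mx.
by congr (\det _); apply/matrixP => a b; rewrite !mxE.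
Qed.

(** * Triangularity with respect to a weight, and characteristic polynomials of compounds *)

(** In a nonzero Leibniz term the weight never increases along [s] and strictly drops at each moved
    point; the total weight being invariant under [s], only the identity survives. The weight need
    not be injective, so sums of indices qualify. *)
Lemma det_weight_trig (K : comNzRingType) (m : nat) (M : 'M[K]_m)
    (w : 'I_m -> nat) :
  (forall p q, p != q -> M p q != 0 -> (w q < w p)%N) -> \det M = \prod_i M i i.
Proof.
move=> trigM; rewrite /determinant (bigD1 1%g) //= [X in _ + X]big1 ?addr0 => [|s s1].
  by rewrite odd_perm1 expr0 mul1r; apply: eq_bigr => i _; rewrite perm1.
have [/existsP[i /eqP i0]|nz] := boolP [exists i, M i (s i) == 0].
  by rewrite (bigD1 i) //= i0 mul0r mulr0.
have {}nz i : M i (s i) != 0 by move: nz; rewrite negb_exists => /forallP/(_ i).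
have lew i : (w (s i) <= w i)%N.
  by case: (eqVneq i (s i)) => [<-//|ne]; apply/ltnW/trigM.
have [i si] : exists i, s i != i.
  apply/existsP; rewrite -negb_forall; apply: contra s1 => /forallP fix_s.
  by apply/eqP/permP => i; rewrite perm1; apply/eqP.
have : (\sum_i w (s i) < \sum_i w i)%N.
  rewrite (bigD1 i) //= [X in (_ < X)%N](bigD1 i) //= -addSn leq_add //.
    by rewrite trigM // eq_sym.
  exact: leq_sum.
by rewrite [X in (_ < X)%N](reindex_inj (@perm_inj _ s)) ltnn.
Qed.

Lemma char_poly_weight_trig (K : comNzRingType) (m : nat) (M : 'M[K]_m)
    (w : 'I_m -> nat) :
  (forall p q, p != q -> M p q != 0 -> (w q < w p)%N) ->
  char_poly M = \prod_i ('X - (M i i)%:P).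
Proof.
move=> trigM; rewrite /char_poly (@det_weight_trig _ _ _ w) => [|p q pq].
  by apply: eq_bigr => i _; rewrite !mxE eqxx mulr1n.
rewrite !mxE (negPf pq) mulr0n sub0r oppr_eq0 polyC_eq0; exact: trigM.
Qed.

Lemma char_poly_intertwine (F : fieldType) (m : nat) (P A T : 'M[F]_m) :
  P \in unitmx -> P *m A = T *m P -> char_poly A = char_poly T.
Proof.
move=> uP PA; pose Q := map_mx (@polyC F) P.
have dQ : \det Q != 0.
  by rewrite det_map_mx polyC_eq0; move: uP; rewrite unitmxE unitfE.
apply: (mulfI dQ); rewrite /char_poly -det_mulmx mulrC -det_mulmx.
by rewrite mulmxBr mulmxBl -!map_mxM PA scalar_mxC.
Qed.

Lemma det_mxsub_eq0_or_perm (K : comNzRingType) (m n j : nat) (A : 'M[K]_(m, n))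
    (f : 'I_j -> 'I_m) (g : 'I_j -> 'I_n) :
  \det (mxsub f g A) != 0 -> exists s : 'S_j, forall a, A (f a) (g (s a)) != 0.
Proof.
move=> nz; have [/existsP[s /forallP sP]|nex] :=
  boolP [exists s : 'S_j, forall a, A (f a) (g (s a)) != 0]; first by exists s.
case/eqP: nz; rewrite /determinant big1 // => s _.
move: nex; rewrite negb_exists => /forallP/(_ s); rewrite negb_forall.
case/existsP => a; rewrite negbK => /eqP a0.
by rewrite (bigD1 a) //= mxE a0 mul0r mulr0.
Qed.

(** A nonzero minor has a nonzero Leibniz term, which matches the two index sets so that [g] drops
    weakly at each place. Equal sums would force every matched pair to agree, hence p = q. *)
Lemma compound_weight_trig (K : comNzRingType) (n j : nat) (T : 'M[K]_n)
    (g : 'I_n -> nat) :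
    (forall i k, i != k -> T i k != 0 -> (g k < g i)%N) ->
  forall p q, p != q -> compound j T p q != 0 ->
    (\sum_a g (idx q a) < \sum_a g (idx p a))%N.
Proof.
move=> trigT p q pq; rewrite compoundE => /det_mxsub_eq0_or_perm[s nz].
have les a : (g (idx q (s a)) <= g (idx p a))%N.
  by case: (eqVneq (idx p a) (idx q (s a))) => [->//|ne]; apply/ltnW/trigT.
rewrite (reindex_inj (@perm_inj _ s)) /=.
rewrite ltn_neqAle leq_sum // andbT; apply: contra pq => /eqP eqs.
apply/eqP/esym/(@idx_perm_inj n j q p s) => i.
apply/eqP; move: eqs; rewrite (bigD1 i) //= [RHS](bigD1 i) //= => eqs.
apply/negPn/negP => ne.
suff : (g (idx q (s i)) + \sum_(a < j | a != i) g (idx q (s a)) <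
        g (idx p i) + \sum_(a < j | a != i) g (idx p a))%N by rewrite eqs ltnn.
by rewrite -addSn leq_add ?leq_sum // trigT // eq_sym.
Qed.

Lemma compound_weight_trig_diag (K : comNzRingType) (n j : nat) (T : 'M[K]_n)
    (g : 'I_n -> nat) p :
    (forall i k, i != k -> T i k != 0 -> (g k < g i)%N) ->
  compound j T p p = \prod_a T (idx p a) (idx p a).
Proof.
move=> trigT; rewrite compoundE (@det_weight_trig _ _ _ (g \o idx p)).
  by apply: eq_bigr => a _; rewrite mxE.
move=> a b ab; rewrite mxE; apply: trigT.
by apply: contra ab => /eqP/(increasing_inj (@idx_increasing n j p)) ->.
Qed.

Lemma diag_weight_trig (K : comNzRingType) (n : nat) (T : 'M[K]_n)
    (g : 'I_n -> nat) : is_diag_mx T ->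
  forall i k, i != k -> T i k != 0 -> (g k < g i)%N.
Proof. by move=> /is_diag_mxP diagT i k /diagT ->; rewrite eqxx. Qed.

Lemma compound_diag (K : comNzRingType) (n j : nat) (T : 'M[K]_n) p q :
  is_diag_mx T -> p != q -> compound j T p q = 0.
Proof.
move=> /is_diag_mxP diagT; apply: contraNeq; rewrite compoundE.
move=> /det_mxsub_eq0_or_perm[s nz]; apply/eqP/esym/(@idx_perm_inj n j q p s) => i.
apply: val_inj; apply/eqP; apply/negPn; apply: contra (nz i) => ne.
by apply/eqP/diagT; rewrite eq_sym.
Qed.

Lemma compound1 (K : comNzRingType) (n j : nat) :
  compound j (1%:M : 'M[K]_n) = 1%:M.
Proof.
apply/matrixP => p q; rewrite [RHS]mxE; case: (eqVneq p q) => [<-|pq].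
  rewrite (compound_weight_trig_diag p
    (@diag_weight_trig K n _ val (scalar_mx_is_diag n 1))).
  by rewrite big1 // => a _; rewrite mxE eqxx.
by rewrite compound_diag // scalar_mx_is_diag.
Qed.

Lemma compoundX (K : comNzRingType) (n j k : nat) (A : 'M[K]_n) :
  compound j (A ^+ k) = compound j A ^+ k.
Proof.
elim: k => [|k IHk]; first by rewrite !expr0 compound1.
by rewrite !exprS compoundM IHk.
Qed.

Lemma compound_unitmx (F : fieldType) (n j : nat) (P : 'M[F]_n) :
  P \in unitmx -> compound j P \in unitmx.
Proof.
move=> uP; have : compound j P *m compound j (invmx P) = 1%:M.
  by rewrite -compoundM mulmxV // compound1.
by case/mulmx1_unit.
Qed.

Lemma char_poly_compound (F : fieldType) (n j : nat) (P A T : 'M[F]_n)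
    (g : 'I_n -> nat) :
    P \in unitmx -> P *m A = T *m P ->
    (forall i k, i != k -> T i k != 0 -> (g k < g i)%N) ->
  char_poly (compound j A) =
    \prod_p ('X - (\prod_a T (@idx n j p a) (idx p a))%:P).
Proof.
move=> uP PA trigT.
rewrite (@char_poly_intertwine _ _ (compound j P) _ (compound j T)).
- rewrite (char_poly_weight_trig (compound_weight_trig trigT)).
  by apply: eq_bigr => p _; rewrite (compound_weight_trig_diag p trigT).
- exact: compound_unitmx.
- by rewrite -!compoundM PA.
Qed.

Lemma trigonalizable_closed (C : numClosedFieldType) (n : nat) (A : 'M[C]_n) :
  exists P T : 'M[C]_n, [/\ P \in unitmx, P *m A = T *m P & is_trig_mx T].
Proof.
case: n A => [|n] A.
  exists 1%:M, A; split; rewrite ?unitmx1 ?mul1mx ?mulmx1 //.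
  by apply/is_trig_mxP => -[].
have [//|P uniP trigP] := Schur A.
have uP := unitarymx_unit uniP.
exists P, (P *m A *m invmx P); split => //; first by rewrite mulmxKV.
by rewrite -conjumx.
Qed.

(** * Perron-Frobenius theory *)

Lemma char_poly_trmx (K : comNzRingType) (m : nat) (B : 'M[K]_m) :
  char_poly B^T = char_poly B.
Proof.
rewrite /char_poly -det_tr; congr (\det _).
by apply/matrixP => i j; rewrite !mxE eq_sym.
Qed.

Lemma trmxX (K : comNzRingType) (m k : nat) (B : 'M[K]_m) :
  (B ^+ k)^T = B^T ^+ k.
Proof.
elim: k => [|k IHk]; first by rewrite !expr0 trmx1.
by rewrite exprSr exprS [LHS]trmx_mul IHk.
Qed.

Lemma map_mxX (K L : comNzRingType) (phi : {rmorphism K -> L}) (m k : nat)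
    (B : 'M[K]_m) : map_mx phi (B ^+ k) = map_mx phi B ^+ k.
Proof.
elim: k => [|k IHk]; first by rewrite !expr0 map_mx1.
by rewrite !exprS [LHS]map_mxM IHk.
Qed.

Lemma eigenvectorX (K : comNzRingType) (m k : nat) (B : 'M[K]_m) (v : 'cV[K]_m) l :
  B *m v = l *: v -> (B ^+ k) *m v = l ^+ k *: v.
Proof.
move=> Bv; elim: k => [|k IHk]; first by rewrite !expr0 mul1mx scale1r.
by rewrite exprSr -[_ *m v]mulmxA Bv -scalemxAr IHk scalerA -exprS.
Qed.

(* Both sides are the determinant of [[X - B, -s v], [w, 1]] times X - l. *)
Lemma char_poly_deflation (F : fieldType) (m : nat) (B : 'M[F]_m)
    (v : 'cV[F]_m) (w : 'rV[F]_m) (l s : F) :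
    w *m B = l *: w -> (w *m v) 0 0 = 1 ->
  char_poly (B - s *: (v *m w)) * ('X - l%:P) =
    char_poly B * ('X - (l - s)%:P).
Proof.
move=> wB wv; pose Q := char_poly_mx B.
pose V := map_mx (@polyC F) (s *: v); pose W := map_mx (@polyC F) w.
have WQ : W *m Q = ('X - l%:P) *: W.
  rewrite /Q /char_poly_mx mulmxBr -map_mxM wB map_mxZ scalerBl.
  by rewrite mul_mx_scalar.
have WV : W *m V = (s%:P)%:M.
  rewrite -map_mxM; apply/matrixP => i j; rewrite !ord1 mxE -scalemxAr.
  by rewrite mxE wv mulr1 mxE eqxx mulr1n.
pose N := block_mx Q (- V) W (1%:M : 'M_1).
have detN : \det N = char_poly (B - s *: (v *m w)).
  (* A column operation clears the block [W]; what remains in the corner is X - B + s v w. *)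
  have -> : \det N = \det (N *m block_mx 1%:M 0 (- W) 1%:M).
    by rewrite det_mulmx det_lblock !det1 !mulr1.
  rewrite mulmx_block !mulmx1 !mul1mx !mulmx0 !add0r mulNmx mulmxN opprK subrr.
  rewrite det_ublock det1 mulr1 /char_poly; congr (\det _).
  rewrite /Q /char_poly_mx map_mxB opprB addrCA addrC; congr (_ + _).
  by rewrite -map_mxM scalemxAl.
(* This row operation, of determinant X - l, also clears [W], because w is a left eigenvector and so
   [W] Q = (X - l) [W]. *)
have detL : \det (block_mx 1%:M 0 (- W) ('X - l%:P)%:M) = 'X - l%:P.
  by rewrite det_lblock det1 mul1r det_scalar1.
rewrite -detN -[in LHS]detL mulrC -det_mulmx mulmx_block !mul1mx !mul0mx !addr0.
rewrite mulNmx WQ mul_scalar_mx addNr det_ublock; congr (_ * _).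
rewrite mulmx1 mulNmx mulmxN opprK WV -raddfD det_scalar1 /=.
by rewrite polyCB opprB addrCA addrC.
Qed.

(** Induction on the roots replaces the Jordan form: N' = (M - z) N is annihilated by the remaining
    factors, and M^(k+1) N = M^k N' + z M^k N. This is why a general right factor [N] is carried
    along. *)
Lemma power_growth_annihilator (C : numFieldType) (m : nat) (M : 'M[C]_m.+1)
    (r : C) (s : seq C) (N : 'M[C]_m.+1) :
    (forall z, z \in s -> `|z| < r) ->
    horner_mx M (\prod_(z <- s) ('X - z%:P)) *m N = 0 ->
  exists2 c, 0 <= c & forall k i j, `|(M ^+ k *m N) i j| <= c * r ^+ k.
Proof.
elim: s N => [|z s IHs] N lts.
  rewrite big_nil rmorph1 mul1mx => ->; exists 0 => // k i j.
  by rewrite mulmx0 mxE normr0 mul0r.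
rewrite big_cons mulrC rmorphM -[_ *m N]mulmxA => annN.
have [t ts|c' c'0 bnd'] := IHs _ _ annN.
  by apply: lts; rewrite inE ts orbT.
have ltz : `|z| < r by apply: lts; rewrite mem_head.
have rz : 0 < r - `|z| by rewrite subr_gt0.
have r0 : 0 <= r by apply: le_trans (ltW ltz).
(* The double sum covers k = 0; the second term gives c' + |z| c <= r c, which closes the
   recurrence. *)
pose c := \sum_i \sum_j `|N i j| + c' / (r - `|z|).
have sum0 : 0 <= \sum_i \sum_j `|N i j|.
  by apply: sumr_ge0 => i _; apply: sumr_ge0.
exists c => [|k i j]; first by rewrite addr_ge0 // divr_ge0 // ltW.
elim: k => [|k IHk].
  rewrite !expr0 mul1mx mulr1 /c (bigD1 i) //= (bigD1 j) //=.
  rewrite -2!addrA lerDl addr_ge0 //; first by apply: sumr_ge0.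
  rewrite addr_ge0 ?divr_ge0 ?(ltW rz) //.
  by apply: sumr_ge0 => ? _; apply: sumr_ge0.
have -> : M ^+ k.+1 *m N =
    M ^+ k *m (horner_mx M ('X - z%:P) *m N) + z *: (M ^+ k *m N).
  rewrite rmorphB /= horner_mx_X horner_mx_C mulmxBl mulmxBr mul_scalar_mx.
  by rewrite -scalemxAr subrK exprSr mulmxA.
rewrite [X in `|X|]mxE [X in _ + X]mxE; apply: le_trans (ler_normD _ _) _.
rewrite normrM; apply: le_trans (lerD (bnd' k i j) (ler_wpM2l (normr_ge0 z) IHk)) _.
rewrite mulrA -mulrDl exprS mulrA ler_wpM2r ?exprn_ge0 //.
rewrite -lerBrDr [_ * c]mulrC -mulrBr /c mulrDl divfK ?gt_eqF // lerDr.
by rewrite mulr_ge0 // ltW.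
Qed.

Lemma power_growth_closed (C : numClosedFieldType) (m : nat) (M : 'M[C]_m.+1)
    (r : C) : (forall z, root (char_poly M) z -> `|z| < r) ->
  exists2 c, 0 <= c & forall k i j, `|(M ^+ k) i j| <= c * r ^+ k.
Proof.
have [s] := closed_field_poly_normal (char_poly M).
rewrite (monicP (char_poly_monic M)) scale1r => sE ltr.
have [z zs||c c0 bnd] := @power_growth_annihilator _ _ M r s 1%:M.
- by apply: ltr; rewrite sE root_prod_XsubC.
- by rewrite mulmx1 -sE Cayley_Hamilton.
by exists c => // k i j; have := bnd k i j; rewrite mulmx1.
Qed.

Section PerronFrobenius.
Variable R : realType.
Implicit Types (m k : nat).

Local Notation toC := (real_complex R).

(** The norm on [R[i]] takes its values in [R[i]]; this is the same norm as an element of [R]. *)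
Definition modulus (z : R[i]) : R := complex.Re `|z|.

Lemma modulusE (z : R[i]) : toC (modulus z) = `|z|.
Proof. by rewrite RRe_real // normr_real. Qed.

Lemma modulus_ge0 z : 0 <= modulus z.
Proof. by rewrite -ler0c modulusE. Qed.

Lemma ceigenvalueE m (B : 'M[R]_m) z :
  ceigenvalue B z = root (char_poly (map_mx toC B)) z.
Proof. by rewrite -map_char_poly. Qed.

Lemma ceigenvalue_trmx m (B : 'M[R]_m) z : ceigenvalue B^T z = ceigenvalue B z.
Proof. by rewrite /ceigenvalue char_poly_trmx. Qed.

Lemma ceigenvalueP m (B : 'M[R]_m) z : ceigenvalue B z ->
  exists2 x : 'cV[R[i]]_m, x != 0 & map_mx toC B *m x = z *: x.
Proof.
rewrite -ceigenvalue_trmx ceigenvalueE -eigenvalue_root_char => /eigenvalueP.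
case=> x xB x0; exists x^T; first by rewrite trmx_eq0.
by rewrite -[map_mx _ B]trmxK -trmx_mul map_trmx xB linearZ.
Qed.

Lemma power_growth m (B : 'M[R]_m) (r : R) :
    (forall z, ceigenvalue B z -> modulus z < r) ->
  exists2 c, 0 <= c & forall k i j, `|(B ^+ k) i j| <= c * r ^+ k.
Proof.
case: m B => [|m] B ltr; first by exists 0 => // ? [].
have [z|c c0 bnd] := @power_growth_closed _ m (map_mx toC B) (toC r).
  by rewrite -ceigenvalueE => /ltr; rewrite -ltcR modulusE.
have cR : toC (complex.Re c) = c by rewrite RRe_real // ger0_real.
exists (complex.Re c) => [|k i j]; first by rewrite -ler0c cR.
have := bnd k i j; rewrite -map_mxX mxE -cR -rmorphXn -rmorphM /=.
have -> : `|toC ((B ^+ k) i j)| = toC `|(B ^+ k) i j|.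
  by rewrite normc_def /= expr0n addr0 sqrtr_sqr.
by rewrite lecR.
Qed.

(** Bernoulli's inequality: (b/a)^t >= 1 + t (b/a - 1), which outgrows any constant. *)
Lemma geometric_domination (a b c : R) : 0 < a -> a < b ->
  exists t0, forall t, (t0 <= t)%N -> c * a ^+ t < b ^+ t.
Proof.
move=> a0 ab; pose e := b / a - 1.
have e0 : 0 < e by rewrite subr_gt0 ltr_pdivlMr // mul1r.
have bern t : 1 + t%:R * e <= (b / a) ^+ t.
  elim: t => [|t IHt]; first by rewrite mul0r addr0 expr0.
  rewrite exprS; move: IHt; have -> : b / a = 1 + e by rewrite /e addrC subrK.
  set y := (1 + e) ^+ t => IHt.
  have t0 : 0 <= t%:R :> R by [].
  rewrite -natr1; nra.
have c0 : 0 <= `|c| / e by rewrite divr_ge0 // ltW.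
exists (Num.bound (`|c| / e)) => t let_.
rewrite -ltr_pdivlMr ?exprn_gt0 // -expr_div_n.
apply: lt_le_trans (bern t); apply: le_lt_trans (ler_norm c) _.
have : `|c| / e < t%:R by apply: lt_le_trans (archi_boundP c0) _; rewrite ler_nat.
rewrite ltr_pdivrMr // => lt1; apply: lt_trans lt1 _; by rewrite ltrDr.
Qed.

Lemma exprn_right_continuous (a q : R) k : 0 <= a -> a ^+ k < q ->
  exists2 b, a < b & b ^+ k < q.
Proof.
move=> a0 ltq.
have [K K0 bnd] : exists2 K, 0 <= K &
    forall d, 0 <= d <= 1 -> (a + d) ^+ k <= a ^+ k + d * K.
  elim: k {ltq} => [|k [K K0 bnd]]; first by exists 0 => // d _; rewrite mulr0 addr0 !expr0.
  exists (a ^+ k + K * a + K) => [|d /andP[d0 d1]].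
    by rewrite !addr_ge0 ?mulr_ge0 ?exprn_ge0.
  rewrite !exprS; apply: le_trans (ler_wpM2l _ (bnd d _)) _; rewrite ?addr_ge0 ?d0 //.
  have := exprn_ge0 k a0; set y := a ^+ k => y0.
  have : 0 <= d * K * (1 - d) by rewrite !mulr_ge0 // subr_ge0.
  nra.
(* Dividing by [K + 1] rather than [K] avoids a zero denominator and makes d K < q - a^k strict. *)
pose d := Num.min 1 ((q - a ^+ k) / (K + 1)).
have K1 : 0 < K + 1 by rewrite ltr_wpDl.
have d0 : 0 < d by rewrite lt_min ltr01 divr_gt0 // subr_gt0.
have d1 : d <= 1 by rewrite ge_min lexx.
have d2 : d * (K + 1) <= q - a ^+ k by rewrite -ler_pdivlMr // ge_min lexx orbT.
exists (a + d); first by rewrite ltrDl.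
apply: le_lt_trans (bnd d _) _; rewrite ?(ltW d0) //; nra.
Qed.

Lemma pos_lower_bound m (f : 'I_m -> R) : (forall i, 0 < f i) ->
  exists2 e, 0 < e & forall i, e <= f i.
Proof.
elim: m f => [|m IHm] f f0; first by exists 1 => // -[].
have [e e0 le_e] := IHm (fun i => f (lift ord0 i)) (fun i => f0 _).
exists (Num.min e (f ord0)); first by rewrite lt_min e0 f0.
move=> i; case: (unliftP ord0 i) => [k ->|->]; rewrite ge_min ?le_e //.
by rewrite lexx orbT.
Qed.

Lemma pos_mulmx_gt0 m (P : 'M[R]_m) (v : 'cV[R]_m) :
    (forall i j, 0 < P i j) -> (forall i, 0 <= v i 0) -> v != 0 ->
  forall i, 0 < (P *m v) i 0.
Proof.
move=> P0 v0 nz i; have [l vl] : exists l, v l 0 != 0.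
  apply/existsP; rewrite -negb_forall; apply: contra nz => /forallP z.
  by apply/eqP/matrixP => a b; rewrite ord1 mxE; apply/eqP.
rewrite mxE (bigD1 l) //= ltr_pwDl ?mulr_gt0 ?P0 //; first by rewrite lt_def vl v0.
by apply: sumr_ge0 => a _; rewrite mulr_ge0 // ltW.
Qed.

Lemma nneg_mulmx_le m (P : 'M[R]_m) (v w : 'cV[R]_m) :
    (forall i j, 0 < P i j) -> (forall i, v i 0 <= w i 0) ->
  forall i, (P *m v) i 0 <= (P *m w) i 0.
Proof.
by move=> P0 vw i; rewrite !mxE; apply: ler_sum => k _; rewrite ler_wpM2l // ltW.
Qed.

(** Iterating the hypothesis gives q^t y <= B^(kt) y. If q > rho^k, some r > rho still has r^k < q,
    and the bound c r^(kt) on the entries of B^(kt) is eventually too small. *)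
Lemma no_superinvariant m (B : 'M[R]_m) (rho q : R) k (y : 'cV[R]_m) :
    (forall z, ceigenvalue B z -> modulus z <= rho) -> 0 <= rho -> (0 < m)%N ->
    (forall i j, 0 < (B ^+ k) i j) -> (forall i, 0 < y i 0) ->
    (forall i, q * y i 0 <= (B ^+ k *m y) i 0) ->
  q <= rho ^+ k.
Proof.
case: m B y => // m B y le_rho rho0 _ Bk0 y0 sup; rewrite leNgt; apply/negP => ltq.
have [r rho_r r_q] := exprn_right_continuous rho0 ltq.
have [z /le_rho lez|c c0 bnd] := @power_growth _ B r; first exact: le_lt_trans rho_r.
have r0 : 0 < r by apply: le_lt_trans rho_r.
have q0 : 0 < q by apply: le_lt_trans r_q; rewrite exprn_ge0 ?ltW.
have iter t i : q ^+ t * y i 0 <= (B ^+ (k * t) *m y) i 0.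
  elim: t i => [|t IHt] i; first by rewrite muln0 !expr0 mul1r mul1mx.
  rewrite mulnS exprD -[_ *m y]mulmxA.
  have le1 : forall l, (q ^+ t *: y) l 0 <= (B ^+ (k * t) *m y) l 0.
    by move=> l; rewrite mxE; apply: IHt.
  apply: le_trans (nneg_mulmx_le Bk0 le1 i).
  rewrite -scalemxAr mxE exprSr -mulrA ler_wpM2l ?sup //.
  by rewrite exprn_ge0 // ltW.
pose Y := \sum_l y l 0.
have [t0 dom] := @geometric_domination (r ^+ k) q (c * Y / y ord0 0) (exprn_gt0 k r0) r_q.
have := dom t0 (leqnn _); apply/negP; rewrite -leNgt.
rewrite mulrAC -exprM -(ler_pM2r (y0 ord0)) divfK ?gt_eqF //.
apply: le_trans (iter t0 ord0) _; rewrite mxE mulrAC mulr_sumr.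
apply: ler_sum => l _; apply: ler_wpM2r; first exact: ltW.
exact: le_trans (ler_norm _) (bnd _ _ _).
Qed.


(** Allowing any eigenvalue [z] of maximal modulus lets one statement serve three ends: existence of
    the Perron vector, simplicity of its eigenvalue, and strict dominance. The last two use the
    constant phase [u]. *)
Lemma perron_eigenvector m (B : 'M[R]_m) (rho : R) (z : R[i]) (x : 'cV[R[i]]_m) :
    (0 < m)%N -> eventually_positive B ->
    (forall z, ceigenvalue B z -> modulus z <= rho) ->
    modulus z = rho -> x != 0 -> map_mx toC B *m x = z *: x ->
  let v := \col_i modulus (x i 0) in
  [/\ 0 < rho, B *m v = rho *: v, forall i, 0 < v i 0 &
      exists2 u, u != 0 & x = u *: map_mx toC v].
Proof.
move=> m0 [k0 Bpos] le_rho zrho x0 Bx v.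
have rho0 : 0 <= rho by rewrite -zrho modulus_ge0.
have v0 i : 0 <= v i 0 by rewrite mxE modulus_ge0.
have vC i : toC (v i 0) = `|x i 0| by rewrite mxE modulusE.
have nzv : v != 0.
  apply: contra x0 => /eqP v00; apply/eqP/matrixP => i j; rewrite ord1 [RHS]mxE.
  by apply/eqP; rewrite -normr_eq0 -vC v00 mxE.
have BkC k i : toC ((B ^+ k *m v) i 0) = \sum_l toC ((B ^+ k) i l) * `|x l 0|.
  rewrite mxE rmorph_sum /=; apply: eq_bigr => l _.
  by rewrite rmorphM /= vC.
have rhoC k i : toC ((rho ^+ k *: v) i 0) =
    `|\sum_l toC ((B ^+ k) i l) * x l 0|.
  have <- : (map_mx toC (B ^+ k) *m x) i 0 = \sum_l toC ((B ^+ k) i l) * x l 0.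
    by rewrite mxE; apply: eq_bigr => l _; rewrite mxE.
  rewrite map_mxX (eigenvectorX k Bx) [X in `|X|]mxE normrM normrX -modulusE zrho.
  by rewrite -vC mxE rmorphM rmorphXn.
have normPx k i l : (k0 <= k)%N ->
    `|toC ((B ^+ k) i l) * x l 0| = toC ((B ^+ k) i l) * `|x l 0|.
  by move=> lek; rewrite normrM ger0_norm // ler0c ltW // Bpos.
have sub k i : (k0 <= k)%N -> (rho ^+ k *: v) i 0 <= (B ^+ k *m v) i 0.
  move=> lek; rewrite -lecR BkC rhoC; apply: le_trans (ler_norm_sum _ _ _) _.
  by apply: ler_sum => l _; rewrite normPx.
(* If d = B^k v - rho^k v were nonzero, then B^k d > 0, and y = B^k v would satisfy B^k y >= (rho^k
   + e) y, where e bounds the ratios of the coordinates of B^k d and y from below. *)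
have Bkv k : (k0 <= k)%N -> B ^+ k *m v = rho ^+ k *: v.
  move=> lek; apply/eqP; rewrite -subr_eq0; apply/negPn/negP => nzd.
  have Bk0 := Bpos k lek; set d := _ - _ in nzd.
  have d0 i : 0 <= d i 0 by rewrite !mxE subr_ge0; have := sub k i lek; rewrite !mxE.
  have y0 := pos_mulmx_gt0 Bk0 v0 nzv; have Pd0 := pos_mulmx_gt0 Bk0 d0 nzd.
  have [e e0 le_e] := @pos_lower_bound _ (fun i => (B ^+ k *m d) i 0 / (B ^+ k *m v) i 0)
     (fun i => divr_gt0 (Pd0 i) (y0 i)).
  suff : rho ^+ k + e <= rho ^+ k by rewrite gerDl leNgt e0.
  apply: (@no_superinvariant m B rho _ k _ le_rho rho0 m0 Bk0 y0) => i; rewrite mulrDl.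
  have -> : (B ^+ k *m (B ^+ k *m v)) i 0 =
      rho ^+ k * (B ^+ k *m v) i 0 + (B ^+ k *m d) i 0.
    have subE (M N : 'cV[R]_m) a : (M - a *: N) i 0 = M i 0 - a * N i 0.
      by rewrite !mxE.
    by rewrite [B ^+ k *m d]mulmxBr -scalemxAr subE addrC subrK.
  by rewrite lerD2l -ler_pdivlMr.
have pv i : 0 < rho ^+ k0 * v i 0.
  have := pos_mulmx_gt0 (Bpos k0 (leqnn _)) v0 nzv i.
  by rewrite (Bkv k0 (leqnn _)) mxE.
have posv i : 0 < v i 0.
  rewrite lt_def v0 andbT; apply/negP => /eqP v00.
  by have := pv i; rewrite v00 mulr0 ltxx.
pose i0 := Ordinal m0.
(* The exponent k0 + 1 is used because k0 may be 0, in which case rho^k0 > 0 says nothing about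
   rho. *)
have prho : 0 < rho.
  have : 0 < rho ^+ k0.+1 * v i0 0.
    have := pos_mulmx_gt0 (Bpos k0.+1 (leqnSn _)) v0 nzv i0.
    by rewrite (Bkv k0.+1 (leqnSn _)) mxE.
  move=> posr; rewrite lt_def rho0 andbT; apply/negP => /eqP rho00.
  by move: posr; rewrite rho00 exprS !mul0r ltxx.
split => //.
  (* Comparing the exponents k0 and k0 + 1 passes from the powers to [B] itself: rho^k0 B v =
     B^(k0+1) v = rho^(k0+1) v. *)
  have := Bkv k0.+1 (leqnSn _); rewrite exprSr -[_ *m v]mulmxA exprS.
  have rk : rho ^+ k0 != 0 by rewrite gt_eqF // exprn_gt0.
  have -> : B ^+ k0 *m (B *m v) = rho ^+ k0 *: (B *m v).
    have comm : B ^+ k0 *m B = B *m B ^+ k0 by rewrite -[LHS]exprSr -[RHS]exprS.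
    by rewrite mulmxA comm -mulmxA (Bkv k0 (leqnn _)) -scalemxAr.
  by rewrite mulrC -scalerA => /(scalerI rk).
(* Equality holds in the triangle inequality for row [i0], so all its terms, and hence all
   coordinates of [x], share one phase. *)
have eqn : `|\sum_l toC ((B ^+ k0) i0 l) * x l 0| =
    \sum_l `|toC ((B ^+ k0) i0 l) * x l 0|.
  rewrite -rhoC -(Bkv k0 (leqnn _)) BkC; apply: eq_bigr => l _.
  by rewrite normPx.
have [u /eqP nu uP] := normC_sum_eq eqn; exists u.
  by rewrite -normr_eq0 nu oner_neq0.
apply/matrixP => l j; rewrite ord1 mxE [X in _ * X]mxE vC.
have nzP : toC ((B ^+ k0) i0 l) != 0.
  by rewrite gt_eqF // -[0](rmorph0 toC) ltcR Bpos.
by apply: (mulfI nzP); rewrite (uP l isT) normPx // mulrCA mulrC mulrA.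
Qed.

Lemma seq_modulus_max (s : seq R[i]) : s != [::] ->
  exists2 z, z \in s & forall z', z' \in s -> modulus z' <= modulus z.
Proof.
elim: s => // a [|b s] IHs _.
  by exists a; rewrite ?mem_head // => z'; rewrite inE => /eqP->.
have [//|z zs zmax] := IHs; case: (leP (modulus a) (modulus z)) => [le_az|lt_za].
  exists z => [|z']; first by rewrite inE zs orbT.
  by rewrite inE => /orP[/eqP->|/zmax].
exists a => [|z']; first by rewrite mem_head.
by rewrite inE => /orP[/eqP->|/zmax /le_trans->] //; apply: ltW.
Qed.

Lemma spectral_radius m (B : 'M[R]_m) : (0 < m)%N ->
  exists2 z, ceigenvalue B z & forall z', ceigenvalue B z' -> modulus z' <= modulus z.
Proof.
move=> m0; have [s] := closed_field_poly_normal (char_poly (map_mx toC B)).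
rewrite (monicP (char_poly_monic _)) scale1r => sE.
have memE z : ceigenvalue B z = (z \in s).
  by rewrite ceigenvalueE sE root_prod_XsubC.
have [|z zs zmax] := @seq_modulus_max s.
  apply: contraTneq m0 => s0; move: (size_char_poly (map_mx toC B)).
  by rewrite sE s0 big_nil size_poly1 => -[<-].
by exists z => [|z']; rewrite memE //; apply: zmax.
Qed.

Lemma eventually_positive_trmx m (B : 'M[R]_m) :
  eventually_positive B -> eventually_positive B^T.
Proof.
by move=> [k0 Bpos]; exists k0 => k lek i j; rewrite -trmxX mxE Bpos.
Qed.

Lemma eventually_positive_perron m (B : 'M[R]_m) :
    (0 < m)%N -> eventually_positive B ->
  exists (rho : R) (v : 'cV[R]_m),
    [/\ 0 < rho, B *m v = rho *: v, forall i, 0 < v i 0 &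
        forall z, ceigenvalue B z -> modulus z <= rho].
Proof.
move=> m0 Bpos; have [z Bz zmax] := spectral_radius B m0.
have [x x0 Bx] := ceigenvalueP Bz.
have [rho0 Bv v0 _] := perron_eigenvector m0 Bpos zmax erefl x0 Bx.
by exists (modulus z), (\col_i modulus (x i 0)).
Qed.

Lemma dot_pos m (w : 'rV[R]_m) (v : 'cV[R]_m) :
  (0 < m)%N -> (forall i, 0 < w 0 i) -> (forall i, 0 < v i 0) -> 0 < (w *m v) 0 0.
Proof.
move=> m0 w0 v0; rewrite mxE (bigD1 (Ordinal m0)) //= ltr_pwDl ?mulr_gt0 //.
by apply: sumr_ge0 => i _; rewrite mulr_ge0 // ltW.
Qed.

(** Evaluating u^T B v in two ways gives rho' u^T v = rho u^T v with u^T v > 0, so the eigenvalues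
    agree and u^T can be rescaled. *)
Lemma left_eigenvector_normalized m (B : 'M[R]_m) (v u : 'cV[R]_m) (rho rho' : R) :
    (0 < m)%N -> (forall i, 0 < v i 0) -> B *m v = rho *: v ->
    (forall i, 0 < u i 0) -> B^T *m u = rho' *: u ->
  exists w : 'rV[R]_m,
    [/\ w *m B = rho *: w, (w *m v) 0 0 = 1 & forall i, 0 < w 0 i].
Proof.
move=> m0 v0 Bv u0 Bu.
have uB : u^T *m B = rho' *: u^T by rewrite -[B]trmxK -trmx_mul Bu linearZ.
have uv0 : 0 < (u^T *m v) 0 0 by apply: dot_pos => // i; rewrite mxE.
have rhoE : rho' = rho.
  have : (u^T *m B *m v) 0 0 = (u^T *m (B *m v)) 0 0 by rewrite mulmxA.
  rewrite uB Bv -scalemxAl -scalemxAr !mxE => /mulIf -> //.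
  by rewrite gt_eqF //; move: uv0; rewrite mxE.
exists (((u^T *m v) 0 0)^-1 *: u^T); split.
- by rewrite -scalemxAl uB rhoE scalerA mulrC -scalerA.
- by rewrite -scalemxAl mxE mulVf // gt_eqF.
by move=> i; rewrite mxE [X in _ * X]mxE mulr_gt0 ?invr_gt0.
Qed.

Lemma eventually_positive_strong_PF m (B : 'M[R]_m) :
  (0 < m)%N -> eventually_positive B -> strong_PF B.
Proof.
move=> m0 Bpos; have [rho [v [rho0 Bv v0 le_rho]]] := eventually_positive_perron m0 Bpos.
have BTpos := eventually_positive_trmx Bpos.
have [rho' [w' [_ Bw' w'0 _]]] := eventually_positive_perron m0 BTpos.
have le_rhoT z : ceigenvalue B^T z -> modulus z <= rho.
  by rewrite ceigenvalue_trmx; apply: le_rho.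
have [w [wB wv _]] := left_eigenvector_normalized m0 v0 Bv w'0 Bw'.
exists rho; split => //; last by exists v.
- split.
    rewrite dvdp_XsubCl -eigenvalue_root_char; apply/eigenvalueP; exists w => //.
    by apply: contra_eq_neq wv => ->; rewrite mul0mx mxE eq_sym oner_neq0.
  (* If rho were a double root, it would survive the deflation by rho v w. A left eigenvector y of
     the deflated matrix for rho satisfies y v = 0, so it is one of [B] too; constant phase makes it
     a multiple of a positive vector, contradicting y v = 0. *)
  move=> dvd2; have := char_poly_deflation rho wB wv; rewrite subrr subr0 => defl.
  have : ('X - rho%:P) ^+ 2 %| char_poly (B - rho *: (v *m w)) * ('X - rho%:P).
    by rewrite defl dvdp_mulr.
  rewrite expr2 dvdp_mul2r ?polyXsubC_eq0 // dvdp_XsubCl -eigenvalue_root_char.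
  case/eigenvalueP => y yB' y0.
  have yv : (y *m v) 0 0 = 0.
    have := congr1 (fun M => (M *m v) 0 0) yB'.
    have -> : y *m (B - rho *: (v *m w)) *m v = 0.
      have wv1 : w *m v = 1%:M by apply/matrixP => i j; rewrite !ord1 wv mxE.
      by rewrite -mulmxA mulmxBl Bv -scalemxAl -mulmxA wv1 mulmx1 subrr mulmx0.
    rewrite -scalemxAl [LHS]mxE [RHS]mxE => /esym/eqP.
    by rewrite mulf_eq0 gt_eqF //= => /eqP.
  have yB : y *m B = rho *: y.
    rewrite -yB' mulmxBr -scalemxAr mulmxA.
    have -> : y *m v = 0 by apply/matrixP => i j; rewrite !ord1 yv mxE.
    by rewrite mul0mx scaler0 subr0.
  have mrho : modulus (toC rho) = rho.
    by apply: complexI; rewrite modulusE ger0_norm // ler0c ltW.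
  have yT0 : map_mx toC y^T != 0.
    by apply: contra y0; rewrite map_mx_eq0 trmx_eq0.
  have ByT : map_mx toC B^T *m map_mx toC y^T = toC rho *: map_mx toC y^T.
    by rewrite -map_mxM -trmx_mul yB linearZ /= map_mxZ.
  have [_ _ posy [u u0 uE]] := perron_eigenvector m0 BTpos le_rhoT mrho yT0 ByT.
  set a := \col_i _ in posy uE.
  have : map_mx toC (a^T *m v) 0 0 = 0.
    apply: (mulfI u0); rewrite mulr0 map_mxM.
    have := congr1 toC yv; rewrite rmorph0 => <-.
    have -> : toC ((y *m v) 0 0) = (map_mx toC (y^T)^T *m map_mx toC v) 0 0.
      by rewrite -map_mxM trmxK [RHS]mxE.
    by rewrite -[map_mx toC (y^T)^T]map_trmx uE linearZ /= -scalemxAl map_trmx [RHS]mxE.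
  rewrite mxE => /eqP; rewrite fmorph_eq0 => /eqP av.
  suff : 0 < (a^T *m v) 0 0 by rewrite av ltxx.
  by apply: dot_pos => // i; rewrite mxE.
move=> z Bz zrho; rewrite -modulusE ltcR lt_neqAle le_rho // andbT.
apply: contra zrho => /eqP mz; have [x x0 Bx] := ceigenvalueP Bz.
(* A multiple of the positive eigenvector for rho, [x] has eigenvalue rho as well as z. *)
have [_ Ba posa [u u0 xE]] := perron_eigenvector m0 Bpos le_rho mz x0 Bx.
set a := \col_i _ in Ba posa xE.
have : z *: x = toC rho *: x.
  by rewrite -Bx {1}xE -scalemxAr -map_mxM Ba map_mxZ scalerA mulrC -scalerA -xE.
move/eqP; rewrite -subr_eq0 -scalerBl scaler_eq0 (negPf x0) orbF subr_eq0.
by [].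
Qed.

Lemma strong_PF_eventually_positive m (B : 'M[R]_m) :
  strong_PF B -> strong_PF B^T -> eventually_positive B.
Proof.
case: m B => [|m] B; first by exists 0%N => ? _ [].
move=> [rho [rho0 simple dom [v [v0 Bv]]]] [rho' [_ _ _ [w' [w'0 Bw']]]].
have [w [wB wv w0]] := left_eigenvector_normalized (ltn0Sn m) v0 Bv w'0 Bw'.
pose B' := B - rho *: (v *m w).
have defl : char_poly B' * ('X - rho%:P) = char_poly B * 'X.
  by rewrite (char_poly_deflation rho wB wv) subrr subr0.
have [z B'z zmax] := @spectral_radius _ B' (ltn0Sn m).
(* A root of the deflated polynomial is 0 or an eigenvalue of [B]. It cannot be rho, which would
   then be a double root for [B]; any other eigenvalue is controlled by dominance. *)
have lt_rho : modulus z < rho.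
  have := congr1 (fun p => root (map_poly toC p) z) defl.
  rewrite /= !rmorphM /= !rootM -/(ceigenvalue B' z) -/(ceigenvalue B z) B'z /=.
  rewrite map_polyX rootX => /esym/orP[Bz|/eqP->]; last first.
    by rewrite -ltcR modulusE normr0 -[0](rmorph0 toC) ltcR.
  have [zrho|zrho] := eqVneq z (toC rho); last first.
    by rewrite -ltcR modulusE dom.
  case: simple => _ []; rewrite -(@Gauss_dvdpl _ _ 'X); last first.
    rewrite coprimepX /root horner_exp hornerXsubC sub0r expf_eq0 /= oppr_eq0.
    by rewrite gt_eqF.
  rewrite -defl expr2 dvdp_mul2r ?polyXsubC_eq0 // dvdp_XsubCl.
  by move: B'z; rewrite zrho /ceigenvalue (fmorph_root toC).
have [r /andP[zr r_rho]] : exists r, modulus z < r < rho.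
  exists ((modulus z + rho) / 2); lra.
have [t /zmax|c c0 bnd] := @power_growth _ B' r; first by move/le_lt_trans; apply.
have r0 : 0 < r by apply: le_lt_trans zr; apply: modulus_ge0.
(* The mixed terms vanish since w B' = 0. The identity starts at exponent 1: at exponent 0 it would
   read 1 = 1 + v w. *)
have Bk k : B ^+ k.+1 = B' ^+ k.+1 + rho ^+ k.+1 *: (v *m w).
  elim: k => [|k IHk]; first by rewrite !expr1 subrK.
  have wB' : w *m B' = 0.
    have wv1 : w *m v = 1%:M by apply/matrixP => i j; rewrite !ord1 wv mxE.
    by rewrite mulmxBr wB -scalemxAr mulmxA wv1 mul1mx subrr.
  have BB' : B *m B' ^+ k.+1 = B' ^+ k.+2.
    have BE : B = B' + rho *: (v *m w) by rewrite subrK.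
    rewrite {1}BE mulmxDl -scalemxAl exprS -[X in rho *: X]mulmxA.
    by rewrite [w *m _]mulmxA wB' mul0mx mulmx0 scaler0 addr0 -exprS.
  rewrite exprS IHk [LHS]mulmxDr BB' -scalemxAr mulmxA Bv -scalemxAl scalerA.
  by rewrite -exprSr.
have [e e0 le_e] := @pos_lower_bound _ (fun i => v i 0) v0.
have [f f0 le_f] := @pos_lower_bound _ (fun i => w 0 i) w0.
(* Entries of v w are at least e f, so this threshold makes rho^k e f exceed the error c r^k. *)
have [t0 big] := @geometric_domination r rho (c / (e * f)) r0 r_rho.
exists t0.+1 => -[//|k] lek i j.
rewrite Bk [X in 0 < X]mxE [X in _ + X]mxE.
have := bnd k.+1 i j; rewrite ler_norml => /andP[lo _].
have := big k.+1 (ltnW lek); rewrite mulrAC ltr_pdivrMr ?mulr_gt0 // => dom'.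
have -> : (v *m w) i j = v i 0 * w 0 j by rewrite mxE big_ord1.
have : rho ^+ k.+1 * (e * f) <= rho ^+ k.+1 * (v i 0 * w 0 j).
  apply: ler_wpM2l; first by rewrite exprn_ge0 // ltW.
  by apply: ler_pM => //; apply: ltW.
lra.
Qed.

End PerronFrobenius.

(** * Sign changes and minors *)

Section SignChanges.
Variable R : realType.

(* The signs of the entries alternate, the first one being the sign of e. *)
Fixpoint alternating (e : R) (s : seq R) : bool :=
  if s is a :: s' then (0 < e * a) && alternating (- e) s' else true.

Lemma same_sign_gt0 (e e' a : R) : 0 < e * e' -> (0 < e * a) = (0 < e' * a).
Proof.
have half (d d' : R) : 0 < d * d' -> 0 < d * a -> 0 < d' * a.
  move=> dd' da; have d2 : 0 < d ^+ 2.
    by rewrite exprn_even_gt0 //=; apply: contraTneq da => ->; rewrite mul0r ltxx.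
  rewrite -(pmulr_rgt0 _ d2); have -> : d ^+ 2 * (d' * a) = (d * d') * (d * a) by ring.
  exact: mulr_gt0.
by move=> ee'; apply/idP/idP; apply: half; rewrite // mulrC.
Qed.

Lemma alternating_same_sign (e e' : R) s :
  0 < e * e' -> alternating e s = alternating e' s.
Proof.
elim: s e e' => //= a s IHs e e' ee'; rewrite (same_sign_gt0 a ee').
by rewrite (IHs _ (- e')) // mulrNN.
Qed.

Lemma alternatingP (e : R) (s : seq R) :
  alternating e s <-> forall i, (i < size s)%N -> 0 < (-1) ^+ i * e * s`_i.
Proof.
elim: s e => [|a s IHs] e /=; first by split.
have sE i : (-1) ^+ i * - e = (-1) ^+ i.+1 * e.
  by rewrite exprS mulN1r mulrN mulNr.
split=> [/andP[ea /IHs alt] [|i] lti|alt].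
- by rewrite expr0 mul1r.
- by have := alt i lti; rewrite sE.
apply/andP; split; first by have := alt 0%N isT; rewrite expr0 mul1r.
by apply/IHs => i lti; rewrite sE; apply: (alt i.+1 lti).
Qed.

Lemma mulr_gt0_nlt0 (a b : R) : a != 0 -> b != 0 -> (0 < a * b) = ~~ (a * b < 0).
Proof. by move=> a0 b0; rewrite -leNgt lt_def mulf_neq0. Qed.

(** Built from the right: [x] is prepended when the sign flips, and otherwise dropped, since the
    subsequence of the tail already starts with its sign. *)
Lemma sign_changes_alternating (T : eqType) (v : T -> R) (x : T) (s : seq T) :
    (forall y, v y != 0) ->
  exists t, [/\ subseq t (x :: s), size t = (sign_changes (map v (x :: s))).+1 &
                alternating (v x) (map v t)].
Proof.
move=> v0; elim: s x => [|y s IHs] x.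
  exists [:: x]; split; rewrite //= ?eqxx // andbT.
  by rewrite -expr2 exprn_even_gt0 //= v0.
have [t [subt szt altt]] := IHs y.
have -> : sign_changes (map v [:: x, y & s]) =
  ((v x * v y < 0)%R + sign_changes (map v (y :: s)))%N by [].
case: ltP => [neg|nneg].
  exists (x :: t); split; rewrite /= ?eqxx ?szt // -expr2 exprn_even_gt0 //= v0 /=.
  by rewrite -(alternating_same_sign _ (e := v y)) // mulrN oppr_gt0 mulrC.
exists t; split => //; first exact: subseq_trans subt (subseq_cons _ _).
rewrite -(alternating_same_sign _ (e := v y)) // mulrC lt_def nneg andbT.
by rewrite mulf_neq0.
Qed.

(** The extra unit appears when [x] has the prescribed first sign: only then can [t] begin inside
    the initial run of signs. *)
Lemma alternating_sign_changes (T : eqType) (v : T -> R) (x : T) (s t : seq T) (e : R) :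
    (forall y, v y != 0) -> e != 0 -> subseq t (x :: s) ->
    alternating e (map v t) ->
  (size t <= sign_changes (map v (x :: s)) + (0 < e * v x)%R)%N.
Proof.
move=> v0; elim: s x t e => [|y s IHs] x t e e0.
  case: t => [|a t] //=; case: (eqVneq a x) => [->|_]; last by [].
  by move=> /eqP -> /= /andP[->].
have -> : sign_changes (map v [:: x, y & s]) =
  ((v x * v y < 0)%R + sign_changes (map v (y :: s)))%N by [].
have vxy := mulr_gt0_nlt0 (v0 x) (v0 y).
case: t => [|a t] //; rewrite [subseq _ _]/=; case: (eqVneq a x) => [->|_] subt.
  move=> /= /andP[evx alt]; rewrite evx.
  have ne0 : - e != 0 by rewrite oppr_eq0.
  have := IHs y t (- e) ne0 subt alt.
  have -> : (0 < - e * v y)%R = (v x * v y < 0).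
    rewrite mulNr oppr_gt0 -[RHS]negbK -vxy.
    by rewrite -(same_sign_gt0 (v y) evx) (mulr_gt0_nlt0 e0 (v0 y)) negbK.
  by rewrite addn1 ltnS [X in (_ <= X)%N]addnC.
move=> alt; have := IHs y (a :: t) e e0 subt alt.
move/leq_trans; apply; rewrite [X in (_ <= X + _)%N]addnC -addnA leq_add2l.
have [evx|/negPf nevx] := boolP (0 < e * v x)%R.
  by case: (0 < _)%R; rewrite ?addn1.
case: (boolP (v x * v y < 0)) => [neg|/negPf]; first by case: (0 < _)%R.
move=> nneg; rewrite nneg in vxy; rewrite mulrC in nevx.
by rewrite mulrC -(same_sign_gt0 e (vxy : 0 < v x * v y)) nevx.
Qed.

Definition fill (n : nat) (x : 'cV[R]_n) (b : 'I_n -> bool) (i : 'I_n) : R :=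
  if x i ord0 == 0 then (if b i then 1 else -1) else x i ord0.

Lemma fill_neq0 n (x : 'cV[R]_n) b i : fill x b i != 0.
Proof.
rewrite /fill; case: ifP => [_|->] //; case: (b i); rewrite ?oppr_eq0 oner_eq0 //.
Qed.

(** With its converse, this trades [Splus] for weak alternation along j + 1 increasing indices, with
    no filling of zeros left. A filled zero satisfies the weak inequality whatever sign it
    received. *)
Lemma Splus_ge_alternating n j (x : 'cV[R]_n) : (0 < n)%N -> (j <= Splus x)%N ->
  exists f : 'I_j.+1 -> 'I_n, exists e, [/\ increasing f, e != 0 &
    forall a : 'I_j.+1, 0 <= (-1) ^+ a * e * x (f a) 0].
Proof.
move=> n0 lej; have ne : (0 < #|{: {ffun 'I_n -> bool}}|)%N.
  by apply/card_gt0P; exists [ffun=> true].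
have [b bE] := bigop.eq_bigmax (fun e : {ffun 'I_n -> bool} =>
  sign_changes [seq fill x e i | i <- enum 'I_n]) ne.
have {}lej : (j <= sign_changes [seq fill x b i | i <- enum 'I_n])%N by rewrite -bE.
case enumE : (enum 'I_n) => [|i0 s] in lej.
  by have := size_enum_ord n; rewrite enumE /= => n00; rewrite -n00 in n0.
have [t [subt szt alt]] := sign_changes_alternating i0 s (fill_neq0 x b).
have nthlt (a : 'I_j.+1) : (a < size t)%N.
  by rewrite szt; apply: leq_trans (ltn_ord a) _.
exists (fun a => nth i0 t a), (fill x b i0); split; last 1 first.
- move=> a; move/alternatingP: alt => /(_ a); rewrite size_map => /(_ (nthlt a)).
  rewrite (nth_map i0) // {2}/fill; case: ifP => [/eqP xz _|_ /ltW //].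
  by rewrite (_ : 0 = ord0) ?xz ?mulr0 //; apply: val_inj.
- move=> a a' lt; have srt : sorted ltn (map val t).
    apply: subseq_sorted (map_subseq val subt) _; first exact: ltn_trans.
    by rewrite -enumE enum_ord_sorted.
  have nE (c : 'I_j.+1) : val (nth i0 t c) = nth 0%N (map val t) c.
    by rewrite (nth_map i0).
  rewrite !nE; apply: (sorted_ltn_nth ltn_trans) srt _ _ _ _ _ => //;
  by rewrite inE size_map.
exact: fill_neq0.
Qed.

Lemma alternating_Splus_ge n j (x : 'cV[R]_n) (f : 'I_j.+1 -> 'I_n) (e : R) :
    increasing f -> e != 0 ->
    (forall a : 'I_j.+1, 0 <= (-1) ^+ a * e * x (f a) 0) ->
  (j <= Splus x)%N.
Proof.
move=> incf e0 alt.
(* A zero at [f a] is filled with the sign required at position a; injectivity of [f] makes this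
   consistent. *)
pose b := [ffun i => [exists a : 'I_j.+1, (f a == i) && (0 < (-1) ^+ a * e)]].
have altb (a : 'I_j.+1) : 0 < (-1) ^+ a * e * fill x b (f a).
  rewrite /fill; case: ifPn => [/eqP xz|xnz]; last first.
    rewrite lt_def alt andbT !mulf_neq0 //.
    by rewrite expf_eq0 oppr_eq0 oner_eq0 andbF.
  have se0 : (-1) ^+ a * e != 0 by rewrite mulf_neq0 // expf_eq0 oppr_eq0 oner_eq0 andbF.
  rewrite ffunE; case: ifPn => [/existsP[a' /andP[/eqP/(increasing_inj incf) -> pos]]|].
    by rewrite mulr1.
  rewrite negb_exists => /forallP/(_ a); rewrite eqxx /= -leNgt => le0.
  by rewrite mulrN1 oppr_gt0 lt_neqAle se0.
rewrite /Splus; apply: leq_trans (bigop.leq_bigmax b).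
case enumE : (enum 'I_n) => [|i0 s].
  by have := mem_enum 'I_n (f ord0); rewrite enumE.
have subf : subseq (map f (enum 'I_j.+1)) (i0 :: s).
  rewrite -enumE; have : map f (enum 'I_j.+1) \in subsets_lex n j.+1.
    by rewrite mem_subsets_lex size_map size_enum_ord eqxx; apply/sorted_map_ord.
  by rewrite mem_combs => /andP[].
have altf : alternating e (map (fill x b) (map f (enum 'I_j.+1))).
  apply/alternatingP => i; rewrite 2!size_map size_enum_ord => lti.
  rewrite -map_comp (nth_map (Ordinal lti)) ?size_enum_ord //.
  have -> : nth (Ordinal lti) (enum 'I_j.+1) i = Ordinal lti.
    exact: (nth_ord_enum (Ordinal lti) (Ordinal lti)).
  exact: altb (Ordinal lti).
have := alternating_sign_changes (fill_neq0 x b) e0 subf altf.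
rewrite size_map size_enum_ord => lej; rewrite -ltnS; apply: leq_trans lej _.
by rewrite -addn1 leq_add2l; case: (0 < _).
Qed.
End SignChanges.

(** * Maximal minors of a column space with bounded sign changes *)

Section MarkovMinors.
Variables (R : realType) (n j : nat).
Implicit Types (Y : 'M[R]_(n, j)) (f : 'I_j -> 'I_n) (g : 'I_j.+1 -> 'I_n).

Lemma increasing_ge f (a : 'I_j) : increasing f -> (a <= f a)%N.
Proof.
move=> incf; case: a => k; elim: k => // k IHk lt_k.
apply: leq_ltn_trans (IHk (ltnW lt_k)) _; exact: incf.
Qed.

Lemma increasing_lift g a : increasing g -> increasing (g \o lift a).
Proof.
move=> incg b c lt_bc; apply: incg; rewrite /= /bump.
by case: (leqP a b) => [le1|lt1]; rewrite ?(leq_trans le1 (ltnW lt_bc)) //=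
  ?add0n ?ltn_add2l // (leq_trans lt_bc) // leq_addl.
Qed.

Lemma det_border g (z : 'cV[R]_j.+1) Y :
  \det (row_mx z (rowsub g Y) : 'M_(1 + j)) =
  \sum_(a < j.+1) (-1) ^+ a * z a 0 * \det (rowsub (g \o lift a) Y).
Proof.
rewrite (expand_det_col _ 0); apply: eq_bigr => a _.
rewrite /cofactor addn0 mulrCA mulrA; congr (_ * _ * _).
  have -> : (0 : 'I_(1 + j)) = lshift j (0 : 'I_1) by apply: val_inj.
  exact: row_mxEl.
congr (\det _); apply/matrixP => b c; rewrite [LHS]mxE [LHS]mxE [RHS]mxE.
have -> : lift 0 c = rshift 1 c by apply: val_inj.
by apply: etrans (row_mxEr _ _ _ _) _; rewrite mxE.
Qed.

(** Bordering the rows [g] of [Y] by the column Y c gives a singular matrix; expand it along that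
    column. *)
Lemma border_relation g Y (c : 'cV[R]_j) :
  \sum_(a < j.+1) (-1) ^+ a * (Y *m c) (g a) 0 * \det (rowsub (g \o lift a) Y) = 0.
Proof.
transitivity (\det (row_mx (rowsub g (Y *m c)) (rowsub g Y) : 'M_(1 + j))).
  by rewrite det_border; apply: eq_bigr => a _; rewrite [X in _ = _ * X * _]mxE.
rewrite -det_tr; apply/eqP/det0P; exists (row_mx 1%:M (- c^T)).
  apply/eqP => /(congr1 (fun M : 'rV[R]_(1 + j) => M 0 (lshift j 0))).
  by rewrite row_mxEl !mxE eqxx => /eqP; rewrite oner_eq0.
rewrite tr_row_mx mul_row_col mul1mx mulNmx -trmx_mul; apply/eqP.
rewrite subr_eq0; apply/eqP; congr trmx.
by apply/matrixP => a b; rewrite !mxE; apply: eq_bigr => k _; rewrite !mxE.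
Qed.

Lemma det_neq0_inj (m : nat) (M : 'M[R]_m) (c : 'cV[R]_m) :
  \det M != 0 -> M *m c = 0 -> c = 0.
Proof.
move=> dM Mc; have uM : M \in unitmx by rewrite unitmxE unitfE.
by rewrite -(mulKmx uM c) Mc mulmx0.
Qed.

Lemma rowsub_mul (m : nat) (h : 'I_m -> 'I_n) Y (c : 'cV[R]_j) i :
  (rowsub h Y *m c) i 0 = (Y *m c) (h i) 0.
Proof. by rewrite !mxE; apply: eq_bigr => k _; rewrite !mxE. Qed.

(** Converse of the relation: a kernel vector of the singular bordered matrix has a nonzero first
    coordinate, as a minor of [Y] on these rows is nonzero; solving for the border column expresses
    [z] through [Y]. *)
Lemma border_span g Y (z : 'cV[R]_j.+1) b :
    \sum_(a < j.+1) (-1) ^+ a * z a 0 * \det (rowsub (g \o lift a) Y) = 0 ->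
    \det (rowsub (g \o lift b) Y) != 0 ->
  exists c : 'cV[R]_j, forall a, (Y *m c) (g a) 0 = z a 0.
Proof.
rewrite -det_border -det_tr => /eqP/det0P[u u0 uN] db.
have {}uN : (row_mx z (rowsub g Y) : 'M_(1 + j)) *m u^T = 0.
  by rewrite -[X in X *m _]trmxK -trmx_mul uN trmx0.
move: uN; rewrite -[u^T]vsubmxK mul_row_col.
set u0' := usubmx _; set u1 := dsubmx _ => uN.
have u0E : u0' = (u0' 0 0)%:M by rewrite [LHS]mx11_scalar.
rewrite u0E mul_mx_scalar in uN.
have nz : u0' 0 0 != 0.
  apply: contra u0 => /eqP z0; rewrite -trmx_eq0 -[u^T]vsubmxK -/u0' -/u1 u0E z0.
  rewrite z0 scale0r add0r in uN.
  have -> : u1 = 0.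
    apply: (det_neq0_inj db); apply/matrixP => i k; rewrite ord1 rowsub_mul /=.
    by rewrite -rowsub_mul uN !mxE.
  by apply/eqP; rewrite raddf0 col_mx0.
exists (- (u0' 0 0)^-1 *: u1) => a; rewrite -rowsub_mul -scalemxAr.
move/eqP: uN; rewrite addrC addr_eq0 => /eqP->.
by rewrite scalerN scaleNr opprK scalerA mulVf // scale1r.
Qed.

(* A vanishing minor yields y <> 0 in the span vanishing on the rows of f; with
   one further row where y is nonzero this is a weakly alternating (j+1)-set. *)
Lemma minor_neq0 Y f : (0 < j)%N ->
    (forall c : 'cV[R]_j, c != 0 -> (Splus (Y *m c) < j)%N) ->
    (forall c : 'cV[R]_j, Y *m c = 0 -> c = 0) ->
  increasing f -> \det (rowsub f Y) != 0.
Proof.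
move=> j0 markov free incf; apply/negP => /eqP d0.
have [c c0 fc] : exists2 c : 'cV[R]_j, c != 0 & rowsub f Y *m c = 0.
  move: d0; rewrite -det_tr => /eqP/det0P[u u0 uN].
  exists u^T; first by rewrite trmx_eq0.
  by rewrite -[X in X *m _]trmxK -trmx_mul uN trmx0.
have yf a : (Y *m c) (f a) 0 = 0 by rewrite -rowsub_mul fc mxE.
have [i0 yi0] : exists i0, (Y *m c) i0 0 != 0.
  apply/existsP; rewrite -negb_forall; apply: contra c0 => /forallP all0.
  apply/eqP/free/matrixP => i k; rewrite ord1 [RHS]mxE; exact/eqP.
pose h (i : 'I_j.+1) := if unlift ord0 i is Some a then f a else i0.
have h0 : h ord0 = i0 by rewrite /h unlift_none.
have hS a : h (lift ord0 a) = f a by rewrite /h liftK.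
have injh : injective h.
  have nif a : f a <> i0 by move=> fa; rewrite -fa yf eqxx in yi0.
  move=> a b; case: (unliftP ord0 a) => [a' ->|->];
    case: (unliftP ord0 b) => [b' ->|->]; rewrite ?h0 ?hS //.
  - by move=> /(increasing_inj incf) ->.
  - by move/nif.
  - by move/esym/nif.
have [p [s hE]] := inj_idx_perm injh.
suff : (j <= Splus (Y *m c))%N by rewrite leqNgt markov.
pose a0 := s ord0.
(* Only the row [i0], at position [a0], carries a nonzero entry; the reference sign is chosen so
   that this entry fits. *)
apply: (@alternating_Splus_ge _ _ _ _ (idx p) ((-1) ^+ a0 * (Y *m c) i0 0)).
- exact: idx_increasing.
- by rewrite mulf_neq0 // expf_eq0 oppr_eq0 oner_eq0 andbF.
move=> a; rewrite -(permKV s a) -hE.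
case: (unliftP ord0 (s^-1 a)%g) => [b bE|bE]; rewrite bE ?hS ?yf ?mulr0 //.
rewrite h0 -/a0; set y := (Y *m c) i0 0.
have -> : (-1) ^+ a0 * ((-1) ^+ a0 * y) * y = ((-1) ^+ a0 * y) ^+ 2 by rewrite expr2; ring.
exact: sqr_ge0.
Qed.

(* Opposite signs would make the vector supported on {a, b} and orthogonal to the
   signed minors weakly alternating, although it lies in the span. *)
Lemma minor_exchange Y g a b : (0 < j)%N ->
    (forall c : 'cV[R]_j, c != 0 -> (Splus (Y *m c) < j)%N) ->
    (forall c : 'cV[R]_j, Y *m c = 0 -> c = 0) ->
  increasing g ->
  0 < \det (rowsub (g \o lift a) Y) * \det (rowsub (g \o lift b) Y).
Proof.
move=> j0 markov free incg.
have nz k : \det (rowsub (g \o lift k) Y) != 0.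
  by apply: minor_neq0 => //; apply: increasing_lift.
set Ma := \det (rowsub (g \o lift a) Y); set Mb := \det (rowsub (g \o lift b) Y).
rewrite lt_def mulf_neq0 ?nz //=; case: leP => // neg.
have ab : a != b by apply: contraTneq neg => ab; rewrite /Ma ab -leNgt -expr2 sqr_ge0.
pose z : 'cV[R]_j.+1 := \col_k (if k == a then (-1) ^+ a * Mb
  else if k == b then - ((-1) ^+ b * Ma) else 0).
have za : z a 0 = (-1) ^+ a * Mb by rewrite mxE eqxx.
have zb : z b 0 = - ((-1) ^+ b * Ma) by rewrite mxE eq_sym (negPf ab) eqxx.
have zk k : k != a -> k != b -> z k 0 = 0 by rewrite mxE => /negPf-> /negPf->.
have sgn2 (k : nat) : (-1) ^+ k * (-1) ^+ k = 1 :> R.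
  by rewrite -exprD addnn -mul2n exprM sqrrN expr1n expr1n.
have [|c cE] := @border_span g Y z a _ (nz a).
  rewrite (bigD1 a) //= (bigD1 b) //=; last by rewrite eq_sym.
  rewrite big1 ?addr0 => [|k /andP[ka kb]]; last by rewrite zk // mulr0 mul0r.
  rewrite za zb -/Ma -/Mb mulrN !mulrA !sgn2; ring.
have c0 : c != 0.
  apply/eqP => c0; have := cE a; rewrite c0 mulmx0 mxE za => /esym/eqP; apply/negP.
  by rewrite mulf_neq0 ?nz // expf_eq0 oppr_eq0 oner_eq0 andbF.
suff : (j <= Splus (Y *m c))%N by rewrite leqNgt markov.
(* With reference sign [Mb], position a contributes Mb^2 and position b contributes - Ma Mb,
   positive by assumption. *)
apply: (@alternating_Splus_ge _ _ _ _ g Mb) => //; first exact: nz.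
move=> k; rewrite cE; have [->|ka] := eqVneq k a.
  rewrite za; have -> : (-1) ^+ a * Mb * ((-1) ^+ a * Mb) = ((-1) ^+ a * (-1) ^+ a) * Mb ^+ 2.
    by rewrite expr2; ring.
  by rewrite sgn2 mul1r sqr_ge0.
have [->|kb] := eqVneq k b; last by rewrite zk // mulr0.
rewrite zb; have -> : (-1) ^+ b * Mb * - ((-1) ^+ b * Ma) =
   - ((-1) ^+ b * (-1) ^+ b) * (Ma * Mb) by ring.
by rewrite sgn2 mulN1r oppr_ge0 ltW.
Qed.

(* If t is the first index with f t <> t, replacing f t by t stays inside the
   (j+1)-set obtained by adding t to the image of f. *)
Lemma minor_initial_sign Y (lejn : (j <= n)%N) : (0 < j)%N ->
    (forall c : 'cV[R]_j, c != 0 -> (Splus (Y *m c) < j)%N) ->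
    (forall c : 'cV[R]_j, Y *m c = 0 -> c = 0) ->
  forall f, increasing f ->
  0 < \det (rowsub (widen_ord lejn) Y) * \det (rowsub f Y).
Proof.
move=> j0 markov free.
suff step d t f : (t + d = j)%N -> (forall a : 'I_j, (a < t)%N -> val (f a) = a) ->
    increasing f -> 0 < \det (rowsub (widen_ord lejn) Y) * \det (rowsub f Y).
  by move=> f; apply: (step j 0%N).
elim: d t f => [|d IHd] t f.
  rewrite addn0 => -> fE incf.
  have -> : rowsub f Y = rowsub (widen_ord lejn) Y.
    by apply/matrixP => a b; rewrite !mxE; congr (Y _ _); apply/val_inj/fE.
  rewrite -expr2 exprn_even_gt0 //= minor_neq0 //.
rewrite addnS => tdj fE incf.
have lt_tj : (t < j)%N by rewrite -tdj ltnS leq_addr.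
pose a0 := Ordinal lt_tj.
have [fa0|fa0] := eqVneq (val (f a0)) t.
  apply: (IHd t.+1); rewrite ?addSn // => a; rewrite ltnS leq_eqVlt.
  by case/orP => [/eqP at0|/fE //]; rewrite at0 -fa0; congr (val (f _)); apply: val_inj.
have lt_tf : (t < f a0)%N.
  by rewrite ltn_neqAle eq_sym fa0 (increasing_ge a0 incf).
(* [g] lists 0, ..., t, f t, f (t+1), ...: dropping position t gives [f], and dropping position t +
   1 replaces f t by t. The defaults of [insubd] are never reached. *)
pose g (k : 'I_j.+1) : 'I_n :=
  if (k <= t)%N then insubd (f a0) (val k) else f (insubd a0 k.-1).
have gl (k : 'I_j.+1) : (k <= t)%N -> val (g k) = k.
  move=> le; rewrite /g le val_insubd (leq_ltn_trans le) //.
  exact: leq_trans lt_tj lejn.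
have gr (k : 'I_j.+1) (b : 'I_j) : (t < k)%N -> val k = b.+1 -> g k = f b.
  move=> lt kb; rewrite /g leqNgt lt /=; congr f; apply: val_inj.
  by rewrite val_insubd kb /= ltn_ord.
have incg : increasing g.
  move=> k l lt_kl; have [lek|ltk] := leqP k t; have [lel|ltl] := leqP l t.
  - by rewrite !gl.
  - have lt_l : (l.-1 < j)%N by rewrite prednK ?(leq_ltn_trans _ ltl) // -ltnS.
    rewrite (gr l (Ordinal lt_l)) //=; last by rewrite prednK // (leq_ltn_trans _ ltl).
    rewrite gl //; apply: leq_ltn_trans lek _; apply: leq_trans lt_tf _.
    have : (t <= l.-1)%N by rewrite -ltnS prednK // (leq_ltn_trans _ ltl).
    rewrite leq_eqVlt => /orP[/eqP tl|tl]; last by apply/ltnW/incf.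
    by have -> : a0 = Ordinal lt_l by apply: val_inj.
  - by have := leq_trans lt_kl lel; rewrite ltnNge (ltnW ltk).
  - have k0 : (0 < k)%N by apply: leq_ltn_trans ltk.
    have l0 : (0 < l)%N by apply: leq_ltn_trans ltl.
    have lt_l : (l.-1 < j)%N by rewrite prednK // -ltnS.
    have lt_k : (k.-1 < j)%N by rewrite prednK // -ltnS.
    rewrite (gr l (Ordinal lt_l)) ?(gr k (Ordinal lt_k)) //= ?prednK //.
    by apply: incf => /=; rewrite -ltnS !prednK.
pose ka := inord t : 'I_j.+1; pose kb := inord t.+1 : 'I_j.+1.
have kaE : val ka = t by apply: inordK; rewrite ltnS ltnW.
have kbE : val kb = t.+1 by apply: inordK.
have fE' : rowsub f Y = rowsub (g \o lift ka) Y.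
  apply/matrixP => a b; rewrite !mxE /=; congr (Y _ _).
  have lE : val (lift ka a) = bump t a by rewrite /= -[in RHS]kaE.
  have [le|lt] := leqP t a.
    by rewrite (gr _ a) // lE /bump le // add1n ltnS.
  have lE' : val (lift ka a) = a by rewrite lE /bump leqNgt lt.
  by apply: val_inj; rewrite fE // gl lE' // ltnW.
have fE2 : forall a : 'I_j, (a < t.+1)%N -> val ((g \o lift kb) a) = a.
  move=> a lt; have lE : val (lift kb a) = bump t.+1 a by rewrite /= -[in RHS]kbE.
  have lE' : val (lift kb a) = a by rewrite lE /bump ltnNge -ltnS lt.
  by rewrite /comp gl lE'.
have pos2 := IHd t.+1 (g \o lift kb) _ fE2 (@increasing_lift g kb incg).
rewrite addSn in pos2; have {}pos2 := pos2 tdj.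
have pos1 := @minor_exchange Y g ka kb j0 markov free incg.
rewrite fE' mulrC -(same_sign_gt0 _ (e := \det (rowsub (g \o lift kb) Y))).
  by rewrite mulrC.
by rewrite mulrC.
Qed.

Lemma markov_minor_sign Y : (0 < j <= n)%N ->
    (forall c : 'cV[R]_j, c != 0 -> (Splus (Y *m c) < j)%N) ->
    (forall c : 'cV[R]_j, Y *m c = 0 -> c = 0) ->
  exists2 e, e != 0 & forall f, increasing f -> 0 < e * \det (rowsub f Y).
Proof.
case/andP=> j0 lejn markov free.
exists (\det (rowsub (widen_ord lejn) Y)); first by apply: minor_neq0.
exact: minor_initial_sign.
Qed.

(** Along a weakly alternating (j+1)-set all terms of [border_relation] have one weak sign, so each
    vanishes. The minors being nonzero, Y c vanishes on the set, and then c = 0. *)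
Lemma minor_sign_markov Y (e : R) (c : 'cV[R]_j) : (0 < j <= n)%N ->
    (forall f, increasing f -> 0 < e * \det (rowsub f Y)) -> c != 0 ->
  (Splus (Y *m c) < j)%N.
Proof.
case/andP=> j0 lejn pos c0; rewrite ltnNge; apply/negP => lej.
have [g [e' [incg e'0 alt]]] := Splus_ge_alternating (leq_trans j0 lejn) lej.
have posM a : 0 < e * \det (rowsub (g \o lift a) Y).
  by apply: pos; apply: increasing_lift.
have := border_relation g Y c; move/(congr1 (fun x => (e * e') * x)).
rewrite mulr0 mulr_sumr => /eqP.
rewrite psumr_eq0 => [/allP all0|a _]; last first.
  have -> : e * e' * ((-1) ^+ a * (Y *m c) (g a) 0 * \det (rowsub (g \o lift a) Y)) =
    ((-1) ^+ a * e' * (Y *m c) (g a) 0) * (e * \det (rowsub (g \o lift a) Y)) by ring.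
  by rewrite mulr_ge0 // ltW.
have yz a : (Y *m c) (g a) 0 = 0.
  have := all0 a; rewrite mem_index_enum => /(_ isT) /=.
  have := posM a; rewrite lt_def mulf_eq0 negb_or => /andP[/andP[/negPf ne /negPf nM] _].
  rewrite !mulf_eq0 ne (negPf e'0) nM orbF expf_eq0 oppr_eq0 oner_eq0 andbF /=.
  by rewrite orbF => /eqP.
case/eqP: c0; apply: (@det_neq0_inj _ (rowsub (g \o lift ord0) Y)).
  by have := posM ord0; rewrite lt_def mulf_eq0 negb_or => /andP[/andP[_ ->]].
by apply/matrixP => i k; rewrite ord1 rowsub_mul /= yz mxE.
Qed.
End MarkovMinors.

(** * Spectra of compounds *)

Section ProductSpectrum.
Variables (R : realType) (m : nat) (B : 'M[R]_m) (I : finType) (F : I -> R[i]).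
Local Notation toC := (real_complex R).
Hypothesis charB :
  char_poly (map_mx toC B) = \prod_i ('X - (F i)%:P).

Lemma ceigenvalue_prod z : ceigenvalue B z <-> exists i, z = F i.
Proof.
rewrite ceigenvalueE charB rootE horner_prod; split.
  move=> /prodf_eq0[i _].
  by rewrite hornerXsubC subr_eq0 => /eqP->; exists i.
by move=> [i ->]; rewrite (bigD1 i) //= hornerXsubC subrr mul0r.
Qed.

(** [F] lists the eigenvalues with multiplicity, so simplicity means that the value is taken at one
    index only. *)
Lemma simple_eigenvalue_prod (i0 : I) (l : R) : F i0 = toC l ->
  simple_eigenvalue B l <-> forall i, i != i0 -> F i != F i0.
Proof.
move=> Fl; have mapX : map_poly toC ('X - l%:P) = 'X - (F i0)%:P.
  by rewrite Fl rmorphB /= map_polyX map_polyC.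
have dvdE p : (p %| char_poly B) =
    (map_poly toC p %| ('X - (F i0)%:P) * \prod_(i | i != i0) ('X - (F i)%:P)).
  by rewrite -(dvdp_map toC) map_char_poly charB (bigD1 i0).
rewrite /simple_eigenvalue !dvdE rmorphXn /= mapX expr2 dvdp_mul2l ?polyXsubC_eq0 //.
rewrite dvdp_mulr // dvdp_XsubCl rootE horner_prod.
have -> : (\prod_(i | i != i0) ('X - (F i)%:P).[F i0] == 0) =
    [exists i, (i != i0) && (F i == F i0)].
  apply/prodf_eq0/existsP => [[i ii0 H]|[i /andP[ii0 /eqP Fi]]]; exists i => //.
    by move: H; rewrite hornerXsubC subr_eq0 ii0 => /eqP->; rewrite eqxx.
  by rewrite hornerXsubC Fi subrr.
split=> [[_ /negP]|ne].
  rewrite negb_exists => /forallP ne i ii0; have := ne i; by rewrite ii0.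
by split=> // /existsP[i /andP[ii0]]; rewrite (negPf (ne i ii0)).
Qed.
End ProductSpectrum.

Lemma horner_mx_eigenvector (F : fieldType) (n : nat) (A : 'M[F]_n.+1)
    (v : 'cV[F]_n.+1) (l : F) (p : {poly F}) :
  A *m v = l *: v -> horner_mx A p *m v = p.[l] *: v.
Proof.
move=> Av; elim/poly_ind: p => [|p c IHp].
  by rewrite rmorph0 mul0mx horner0 scale0r.
rewrite rmorphD rmorphM /= horner_mx_X horner_mx_C mulmxDl -[_ *m v]mulmxA Av.
by rewrite -scalemxAr IHp mul_scalar_mx hornerMXaddC scalerDl scalerA mulrC.
Qed.

Lemma distinct_eigenvectors_unitmx (F : fieldType) (n : nat) (A X : 'M[F]_n)
    (l : 'I_n -> F) :
    injective l -> (forall i, col i X != 0) ->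
    (forall i, A *m col i X = l i *: col i X) ->
  X \in unitmx.
Proof.
case: n A X l => [|n] A X l injl X0 eig; first by rewrite unitmxE det_mx00 unitr1.
rewrite unitmxE unitfE -det_tr; apply/negP => /det0P[u u0 uX].
have {}uX : X *m u^T = 0 by rewrite -[X]trmxK -trmx_mul uX trmx0.
case/negP: u0; apply/eqP/matrixP => a i; rewrite ord1 [RHS]mxE.
(* Evaluated at [A], this Lagrange-type polynomial kills every eigenvector but the i-th and isolates
   the i-th coefficient. *)
pose p := \prod_(k | k != i) ('X - (l k)%:P).
have sumX : X *m u^T = \sum_k u 0 k *: col k X.
  apply/matrixP => r c; rewrite ord1 mxE summxE.
  by apply: eq_bigr => k _; rewrite !mxE mulrC.
have := congr1 (fun M => horner_mx A p *m M) uX; rewrite sumX mulmx0 mulmx_sumr.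
rewrite (bigD1 i) //= big1 ?addr0 => [|k ki].
  rewrite -scalemxAr (horner_mx_eigenvector p (eig i)) scalerA => /eqP.
  rewrite scaler_eq0 (negPf (X0 i)) orbF mulf_eq0 => /orP[/eqP //|].
  rewrite horner_prod => /prodf_eq0[k ki]; rewrite hornerXsubC subr_eq0.
  by move/eqP/injl => ik; rewrite ik eqxx in ki.
rewrite -scalemxAr (horner_mx_eigenvector p (eig k)) scalerA.
by rewrite horner_prod (bigD1 k) //= hornerXsubC subrr mul0r mulr0 scale0r.
Qed.

Lemma sorting_perm (R : realType) (n : nat) (f : 'I_n -> R) :
  exists s : 'S_n, forall i k : 'I_n, (i < k)%N -> f (s k) <= f (s i).
Proof.
pose r := [rel i k : 'I_n | f k <= f i].
have rtr : transitive r by move=> a b c /= ba ac; apply: le_trans ac ba.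
have rtot : total r by move=> a b /=; apply: le_total.
have szu : size (sort r (enum 'I_n)) == n by rewrite size_sort size_enum_ord.
pose u : n.-tuple 'I_n := Tuple szu.
have injt : injective (tnth u).
  by apply/tuple_uniqP; rewrite sort_uniq enum_uniq.
exists (perm injt) => i k lt_ik; rewrite !permE !(tnth_nth i) /=.
apply: (sorted_ltn_nth rtr) (sort_sorted rtot _) _ _ _ _ lt_ik => //;
by rewrite inE (eqP szu).
Qed.

(** Permuting the basis sorts the diagonal but destroys triangularity in the usual order; the weight
    [g] remembers the original positions. *)
Lemma trigonalizable_sorted (R : realType) (n : nat) (A : 'M[R[i]]_n) :
  exists P T : 'M[R[i]]_n, exists g : 'I_n -> nat,
  [/\ P \in unitmx, P *m A = T *m P,
      forall i k, i != k -> T i k != 0 -> (g k < g i)%N &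
      forall i k : 'I_n, (i < k)%N -> modulus (T k k) <= modulus (T i i)].
Proof.
have [P [T [uP PA /is_trig_mxP trigT]]] := trigonalizable_closed A.
have [s sP] := sorting_perm (fun i => modulus (T i i)).
pose Q := perm_mx s : 'M[R[i]]_n.
have QT : Q *m T *m Q^T = \matrix_(i, k) T (s i) (s k).
  rewrite -row_permE tr_perm_mx -col_permE.
  by apply/matrixP => i k; rewrite !mxE.
exists (Q *m P), (Q *m T *m Q^T), (fun i => val (s i)); split.
- by rewrite unitmx_mul unitmx_perm.
- rewrite -[RHS]mulmxA [Q^T *m _]mulmxA tr_perm_mx -perm_mxM mulVg perm_mx1 mul1mx.
  by rewrite -!mulmxA PA.
- move=> i k ik; rewrite QT mxE => nz; rewrite ltn_neqAle.
  rewrite val_eqE (inj_eq perm_inj) eq_sym ik /= leqNgt; apply/negP => lt.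
  by rewrite trigT // eqxx in nz.
by move=> i k ik; rewrite QT !mxE sP.
Qed.

Lemma col_mul (K : comNzRingType) (m n p : nat) (A : 'M[K]_(m, n))
    (B : 'M[K]_(n, p)) k : col k (A *m B) = A *m col k B.
Proof. by rewrite !colE mulmxA. Qed.

(** * Perron vectors of compounds read off an eigenbasis *)

Section EigenBasis.
Variables (R : realType) (n : nat) (A X : 'M[R]_n) (l : 'I_n -> R).
Local Notation toC := (real_complex R).
Hypothesis l_gt0 : forall i, 0 < l i.
Hypothesis l_decr : forall i k : 'I_n, (i < k)%N -> l k < l i.
Hypothesis X_neq0 : forall i, col i X != 0.
Hypothesis X_eigen : forall i, A *m col i X = l i *: col i X.

Lemma decreasing_inj : injective l.
Proof.
move=> i k lik; apply: val_inj; case: (ltngtP i k) => // /l_decr;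
  by rewrite lik ltxx.
Qed.

Lemma eigenbasis_unitmx : X \in unitmx.
Proof. exact: (distinct_eigenvectors_unitmx decreasing_inj X_neq0 X_eigen). Qed.

Let D : 'M[R]_n := diag_mx (\row_i l i).

Lemma eigenbasis_mul : A *m X = X *m D.
Proof.
apply/matrixP => i k; rewrite mul_mx_diag.
have := congr1 (fun M : 'cV[R]_n => M i 0) (X_eigen k).
by rewrite -col_mul [LHS]mxE !mxE mulrC.
Qed.

Variable j : nat.
Hypothesis j_bounds : (0 < j <= n)%N.
Let lejn : (j <= n)%N.
Proof. by case/andP: j_bounds. Qed.

Let E (p : 'I_(size (subsets_lex n j))) : R := \prod_a l (idx p a).

Lemma compound_eigen_prod p q : compound j D p q = E p *+ (p == q).
Proof.
have diagD : is_diag_mx D by apply: diag_mx_is_diag.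
have [<-|pq] := eqVneq p q; last by rewrite compound_diag.
rewrite (compound_weight_trig_diag p (@diag_weight_trig _ _ _ val diagD)) mulr1n.
by apply: eq_bigr => a _; rewrite !mxE eqxx mulr1n.
Qed.

Lemma char_poly_compound_eigen :
  char_poly (map_mx toC (compound j A)) = \prod_p ('X - (toC (E p))%:P).
Proof.
rewrite -map_char_poly.
have diagD : is_diag_mx D by apply: diag_mx_is_diag.
have uX : invmx X \in unitmx by rewrite unitmx_inv eigenbasis_unitmx.
have XA : invmx X *m A = D *m invmx X.
  apply: (can_inj (mulmxK eigenbasis_unitmx)).
  by rewrite mulmxKV ?eigenbasis_unitmx // -mulmxA eigenbasis_mul mulKmx ?eigenbasis_unitmx.
rewrite (char_poly_compound j uX XA (@diag_weight_trig _ _ _ val diagD)) rmorph_prod /=.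
apply: eq_bigr => p _; rewrite rmorphB /= map_polyX map_polyC /=.
by congr ('X - (toC _)%:P); apply: eq_bigr => a _; rewrite !mxE eqxx mulr1n.
Qed.

Variable p0 : 'I_(size (subsets_lex n j)).
Hypothesis p0E : idx p0 =1 widen_ord lejn.

Lemma eigen_prod_gt0 p : 0 < E p.
Proof. by apply: prodr_gt0. Qed.

(** The a-th element of an index set is at least a and [l] decreases, so each factor is largest for
    the initial set [p0]; a different set loses strictly somewhere. *)
Lemma eigen_prod_lt p : p != p0 -> E p < E p0.
Proof.
move=> pp0; have le_l (a : 'I_j) : l (idx p a) <= l (idx p0 a).
  have : (idx p0 a <= idx p a)%N by rewrite p0E /= increasing_ge //; apply: idx_increasing.
  by rewrite leq_eqVlt => /orP[/eqP/val_inj->|/l_decr/ltW].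
have [a lt_a] : exists a, l (idx p a) < l (idx p0 a).
  apply/existsP; apply: contraR pp0; rewrite negb_exists => /forallP all_ge.
  apply/eqP/idx_inj => a; apply: decreasing_inj; apply: le_anti.
  by rewrite le_l leNgt all_ge.
rewrite /E (bigD1 a) //= [X in _ < X](bigD1 a) //=.
apply: (@lt_le_trans _ _ (l (idx p0 a) * \prod_(i < j | i != a) l (idx p i))).
  by rewrite ltr_pM2r // prodr_gt0.
rewrite ler_pM2l //; apply: ler_prod => b _; by rewrite le_l ltW.
Qed.

Lemma eigen_prod_le p : E p <= E p0.
Proof. by have [->//|/eigen_prod_lt/ltW] := eqVneq p p0. Qed.

Lemma compound_eigenvector :
  compound j A *m col p0 (compound j X) = E p0 *: col p0 (compound j X).
Proof.
rewrite -col_mul -compoundM eigenbasis_mul compoundM.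
apply/matrixP => p q; rewrite mxE mxE [RHS]mxE [X in _ = _ * X]mxE (bigD1 p0) //=.
rewrite compound_eigen_prod eqxx mulr1n big1 ?addr0 => [|r rp]; first by rewrite mulrC.
by rewrite compound_eigen_prod (negPf rp) mulr0n mulr0.
Qed.

(** Column [p0] of the compound of [X] is an eigenvector for the largest product [E p0]; scaling by
    [e] makes it positive. *)
Lemma strong_PF_of_column_sign (e : R) : (forall p, 0 < e * compound j X p p0) ->
  strong_PF (compound j A).
Proof.
move=> pos; exists (E p0); split.
- exact: eigen_prod_gt0.
- apply/(simple_eigenvalue_prod char_poly_compound_eigen (i0 := p0)) => // p.
  by move/eigen_prod_lt/lt_eqF => ne; apply/eqP => /complexI/eqP; rewrite ne.
- move=> z /(ceigenvalue_prod char_poly_compound_eigen)[p ->] ne.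
  rewrite ger0_norm ?ler0c ?ltW ?eigen_prod_gt0 // ltcR eigen_prod_lt //.
  by apply: contra ne => /eqP->.
exists (e *: col p0 (compound j X)); split.
  by move=> p; rewrite mxE [X in _ * X]mxE; apply: pos.
by rewrite -scalemxAr compound_eigenvector scalerA mulrC -scalerA.
Qed.

Lemma column_sign_of_strong_PF : strong_PF (compound j A) ->
  exists e : R, forall p, 0 < e * compound j X p p0.
Proof.
move=> [rho [rho0 _ dom [v [v0 Av]]]].
have charA := char_poly_compound_eigen.
have rhoE : rho = E p0.
  have eigrho : ceigenvalue (compound j A) (toC rho).
    rewrite -ceigenvalue_trmx ceigenvalueE -eigenvalue_root_char.
    apply/eigenvalueP; exists (map_mx toC v^T).
      by rewrite -map_mxM -trmx_mul Av linearZ /= map_mxZ.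
    rewrite map_mx_eq0 trmx_eq0; apply/eqP => v00.
    by have := v0 p0; rewrite v00 mxE ltxx.
  have [p /complexI rhoEp] := (ceigenvalue_prod charA _).1 eigrho.
  have eigp0 := (ceigenvalue_prod charA _).2 (ex_intro _ p0 erefl).
  have := dom _ eigp0; rewrite ger0_norm ?ler0c ?ltW ?eigen_prod_gt0 // ltcR.
  have := eigen_prod_le p; rewrite -rhoEp => le1.
  have [/complexI-> //|_ /(_ isT) lt1] := eqVneq (toC (E p0)) (toC rho).
  by have := le_lt_trans le1 lt1; rewrite ltxx.
have uC := compound_unitmx j eigenbasis_unitmx.
(* In the basis of columns of the compound of [X], the Perron vector has only its [p0] coordinate,
   since the other products differ from rho = [E p0]. *)
pose u := invmx (compound j X) *m v.
have vE : v = compound j X *m u by rewrite mulKVmx.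
have Du : compound j D *m u = rho *: u.
  apply: (can_inj (mulKmx uC)); rewrite mulmxA -compoundM -eigenbasis_mul compoundM.
  by rewrite -mulmxA -vE Av -scalemxAr -vE.
have u0 p : p != p0 -> u p 0 = 0.
  move=> pp0; have := congr1 (fun M : 'cV[R]__ => M p 0) Du.
  rewrite mxE (bigD1 p) //= big1 ?addr0 => [|q qp]; last first.
    by rewrite compound_eigen_prod eq_sym (negPf qp) mulr0n mul0r.
  rewrite compound_eigen_prod eqxx mulr1n [RHS]mxE rhoE => /eqP.
  rewrite -subr_eq0 -mulrBl mulf_eq0 subr_eq0 lt_eqF ?eigen_prod_lt //=.
  by move/eqP.
exists (u p0 0) => p; have := v0 p; rewrite {1}vE mxE (bigD1 p0) //= big1 ?addr0.
  by rewrite mulrC.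
by move=> q qp; rewrite u0 // mulr0.
Qed.
End EigenBasis.

Lemma first_idx (n j : nat) (lejn : (j <= n)%N) :
  exists p0, @idx n j p0 =1 widen_ord lejn.
Proof. by apply: increasing_idx => a b. Qed.

(** * Markov systems and the signs of the initial column of each compound *)

Section Markov.
Variables (R : realType) (n : nat) (x : 'I_n -> 'cV[R]_n).

Definition eigenmx : 'M[R]_n := \matrix_(i, k) x k i 0.

Lemma col_eigenmx k : col k eigenmx = x k.
Proof. by apply/matrixP => i c; rewrite !mxE ord1. Qed.

Lemma markov_sumE j (lejn : (j <= n)%N) (c : 'I_n -> R) :
  \sum_(i < n | (i < j)%N) c i *: x i =
  colsub (widen_ord lejn) eigenmx *m \col_a c (widen_ord lejn a).
Proof.
rewrite (big_ord_narrow lejn); apply/matrixP => i k; rewrite ord1 summxE mxE.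
by apply: eq_bigr => a _; rewrite !mxE mulrC.
Qed.

Lemma compound_eigenmx j (lejn : (j <= n)%N) p0 : idx p0 =1 widen_ord lejn ->
  forall p, compound j eigenmx p p0 =
    \det (rowsub (idx p) (colsub (widen_ord lejn) eigenmx)).
Proof.
move=> p0E p; rewrite compoundE; congr (\det _).
by apply/matrixP => a b; rewrite !mxE p0E.
Qed.

Lemma markov_column_sign j (lejn : (j <= n)%N) p0 : (0 < j)%N ->
    eigenmx \in unitmx -> markov_system x -> idx p0 =1 widen_ord lejn ->
  exists e : R, forall p, 0 < e * compound j eigenmx p p0.
Proof.
move=> j0 uX [_ markov] p0E; have jb : (0 < j <= n)%N by rewrite j0.
pose ext (c : 'cV[R]_j) (i : 'I_n) : R := if insub (val i) is Some a then c a 0 else 0.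
have extE c a : ext c (widen_ord lejn a) = c a 0.
  by rewrite /ext /= (valK a).
have extcol c : \col_a ext c (widen_ord lejn a) = c.
  by apply/matrixP => a b; rewrite mxE extE ord1.
have [c c0|c Yc|e e0 pos] := @markov_minor_sign _ _ _
  (colsub (widen_ord lejn) eigenmx) jb.
- rewrite -[c]extcol -markov_sumE.
  apply: leq_ltn_trans (markov j jb (ext c) _) _; last by rewrite prednK.
  have [a ca] : exists a, c a 0 != 0.
    apply/existsP; rewrite -negb_forall; apply: contra c0 => /forallP all0.
    by apply/eqP/matrixP => a b; rewrite ord1 [RHS]mxE; apply/eqP.
  by exists (widen_ord lejn a); rewrite extE; split; first exact: (ltn_ord a).
(* Extension by zero turns a relation among the first j columns into one among all columns of an
   invertible matrix. *)
- pose c' : 'cV[R]_n := \col_i ext c i.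
  have Xc' : eigenmx *m c' = 0.
    rewrite -Yc -[c in RHS]extcol -markov_sumE; apply/matrixP => i k.
    rewrite ord1 summxE mxE [RHS]big_mkcond; apply: eq_bigr => a _.
    rewrite !mxE; case: ifPn => lt; first by rewrite mulrC.
    by rewrite /ext insubN ?mulr0.
  have c'0 : c' = 0 by rewrite -(mulKmx uX c') Xc' mulmx0.
  apply/matrixP => a b; rewrite ord1 [RHS]mxE -extE.
  by have := congr1 (fun M : 'cV[R]_n => M (widen_ord lejn a) 0) c'0; rewrite !mxE.
exists e => p; rewrite (compound_eigenmx p0E); apply: pos; exact: idx_increasing.
Qed.

Lemma column_sign_markov : (forall i, x i != 0) ->
    (forall j (lejn : (j <= n)%N) p0, (0 < j)%N -> idx p0 =1 widen_ord lejn ->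
       exists e : R, forall p, 0 < e * compound j eigenmx p p0) ->
  markov_system x.
Proof.
move=> x0 sgn; split=> // j jb c [i [ltij ci]]; have /andP[j0 lejn] := jb.
have [p0 p0E] := first_idx lejn; have [e pos] := sgn j lejn p0 j0 p0E.
rewrite (markov_sumE lejn) -ltnS prednK //.
apply: (@minor_sign_markov _ _ _ _ e) => // [f incf|].
  have [p pf] := increasing_idx incf; have := pos p.
  rewrite (compound_eigenmx p0E); congr (0 < _ * \det _).
  by apply/matrixP => a b; rewrite !mxE pf.
apply/eqP => /(congr1 (fun M : 'cV[R]_j => M (Ordinal ltij) 0)).
rewrite !mxE => ci0; case/eqP: ci; rewrite -ci0; congr c; exact: val_inj.
Qed.
End Markov.

Lemma gantmacher_krein_strong_PF (R : realType) (n j : nat) (A : 'M[R]_n) :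
  gantmacher_krein A -> (0 < j <= n)%N -> strong_PF (compound j A).
Proof.
move=> [l [x [l0 ldecr _ eig markov]]] jb; have /andP[j0 lejn] := jb.
have X0 i : col i (eigenmx x) != 0 by rewrite col_eigenmx markov.1.
have Xeig i : A *m col i (eigenmx x) = l i *: col i (eigenmx x).
  by rewrite col_eigenmx eig.
have [p0 p0E] := first_idx lejn.
have uX := eigenbasis_unitmx ldecr X0 Xeig.
have [e pos] := markov_column_sign j0 uX markov p0E.
apply: (@strong_PF_of_column_sign _ _ _ _ _ l0 ldecr X0 Xeig _ jb p0 _ _ pos).
by move=> a; rewrite p0E; apply: val_inj.
Qed.

(** * Recovering the spectrum from the Perron roots of the compounds *)

Section RealSpectrum.
Variables (R : realType) (n : nat) (A : 'M[R]_n).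
Local Notation toC := (real_complex R).

Lemma modulus_prod (I : finType) (F : I -> R[i]) :
  modulus (\prod_i F i) = \prod_i modulus (F i).
Proof.
apply: complexI; rewrite modulusE normr_prod rmorph_prod.
by apply: eq_bigr => i _; rewrite /= modulusE.
Qed.

Lemma modulus_toC (r : R) : 0 <= r -> modulus (toC r) = r.
Proof. by move=> r0; apply: complexI; rewrite modulusE ger0_norm // ler0c. Qed.

Lemma simple_ceigenvalue m (B : 'M[R]_m) r :
  simple_eigenvalue B r -> ceigenvalue B (toC r).
Proof. by rewrite /ceigenvalue (fmorph_root toC) => -[]; rewrite dvdp_XsubCl. Qed.

(* Write t_0, t_1, ... for the eigenvalues by decreasing modulus.  The product
   t_0 ... t_(j-1) has the largest modulus among the eigenvalues of the j-th
   compound, hence is its Perron root; quotients of consecutive Perron roots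
   give t_j > 0, and simplicity of the Perron roots separates the t_j. *)
Lemma strong_PF_real_spectrum :
    (forall j, (0 < j <= n)%N -> strong_PF (compound j A)) ->
  exists l : 'I_n -> R,
    [/\ forall i, 0 < l i, forall i k : 'I_n, (i < k)%N -> l k < l i &
        forall i, simple_eigenvalue A (l i)].
Proof.
move=> PF.
have [P [T [g [uP PA trigT sortT]]]] := trigonalizable_sorted (map_mx toC A).
pose t i := T i i.
have charC j : char_poly (map_mx toC (compound j A)) =
    \prod_p ('X - (\prod_a t (@idx n j p a))%:P).
  by rewrite -compound_map; apply: char_poly_compound uP PA trigT.
have charA : char_poly (map_mx toC A) = \prod_i ('X - (t i)%:P).
  by rewrite (char_poly_intertwine uP PA) (char_poly_weight_trig trigT).
pose Z j := \prod_(a < n | (a < j)%N) t a.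
have ZE j (lejn : (j <= n)%N) p0 : idx p0 =1 widen_ord lejn ->
    \prod_a t (@idx n j p0 a) = Z j.
  by move=> p0E; rewrite /Z (big_ord_narrow lejn); apply: eq_bigr => a _; rewrite p0E.
have le_mod j (lejn : (j <= n)%N) (p : 'I_(size (subsets_lex n j))) :
    modulus (\prod_a t (idx p a)) <= modulus (Z j).
  have [p0 p0E] := first_idx lejn; rewrite -(ZE _ _ _ p0E) !modulus_prod.
  apply: ler_prod => a _; rewrite modulus_ge0 /=.
  have : (idx p0 a <= idx p a)%N.
    by rewrite p0E /= increasing_ge //; apply: idx_increasing.
  by rewrite leq_eqVlt => /orP[/eqP/val_inj->//|]; apply: sortT.
have perron j : (0 < j <= n)%N -> exists2 rho, Z j = toC rho &
    0 < rho /\ simple_eigenvalue (compound j A) rho.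
  move=> jb; have /andP[j0 lejn] := jb; have [p0 p0E] := first_idx lejn.
  have [rho [rho0 simple dom _]] := PF j jb; exists rho => //.
  have [p Ep] := (ceigenvalue_prod (charC j) _).1 (simple_ceigenvalue simple).
  have eigZ : ceigenvalue (compound j A) (Z j).
    by apply/(ceigenvalue_prod (charC j)); exists p0; rewrite (ZE _ _ _ p0E).
  (* If Z j differed from rho, dominance would give |Z j| < rho, although rho is itself a product of
     j eigenvalues and so at most |Z j|. *)
  apply/eqP/negPn/negP => /(dom _ eigZ); rewrite -modulusE ltcR ltNge.
  by rewrite -[X in X <= _](modulus_toC (ltW rho0)) Ep le_mod.
have ZS (i : 'I_n) : Z i.+1 = t i * Z i.
  rewrite /Z (bigD1 i) //=; congr (_ * _); apply: eq_bigl => k.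
  by rewrite ltnS leq_eqVlt andb_orl -val_eqE; case: ltngtP.
have Zpos j : (j <= n)%N -> exists2 r, Z j = toC r & 0 < r.
  case: j => [_|j lejn]; first by exists 1; rewrite // /Z big_pred0.
  by have [r Zr [r0 _]] := perron j.+1 lejn; exists r.
have tpos i : exists r, t i = toC r /\ 0 < r.
  have [r Zr r0] := Zpos i (ltnW (ltn_ord i)).
  have [r' Zr' r'0] := Zpos i.+1 (ltn_ord i).
  exists (r' / r); split; last by rewrite divr_gt0.
  have rC0 : toC r != 0 by rewrite fmorph_eq0 gt_eqF.
  by apply: (mulIf rC0); rewrite -{1}Zr -ZS Zr' -rmorphM /= divfK ?gt_eqF.
have [l lP] := fin_all_exists tpos; exists l.
have l0 i : 0 < l i by have [] := lP i.
have tE i : t i = toC (l i) by have [] := lP i.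
have ldecr (i k : 'I_n) : (i < k)%N -> l k < l i.
  move=> ik; have : l k <= l i.
    have := sortT i k ik; rewrite -/(t k) -/(t i) !tE !modulus_toC //; exact: ltW.
  rewrite le_eqVlt => /orP[/eqP lki|//].
  have [rho Zrho [_ simple]] := perron i.+1 (ltn_ord i).
  have [p0 p0E] := first_idx (ltn_ord i).
  (* If l k = l i, exchanging the last index i of the initial set for k gives a second set with the
     same product, against simplicity of the Perron root. *)
  pose f (a : 'I_i.+1) : 'I_n := if a == ord_max then k else widen_ord (ltn_ord i) a.
  have incf : increasing f.
    move=> a b ab; rewrite /f; case: (eqVneq a ord_max) => [am|_].
      by have := ltn_ord b; rewrite ltnS leqNgt; rewrite am in ab; rewrite ab.
    case: eqP => [bm|_] //=; apply: leq_ltn_trans ik; rewrite -ltnS; exact: ltn_ord.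
  have [p1 p1E] := increasing_idx incf.
  have p10 : p1 != p0.
    apply/eqP => p10; have := p1E ord_max; rewrite p10 p0E /f eqxx.
    by move/(congr1 val) => /= ki; rewrite -ki ltnn in ik.
  have p0rho : \prod_a t (idx p0 a) = toC rho by rewrite (ZE _ _ _ p0E).
  have := (simple_eigenvalue_prod (charC i.+1) p0rho).1 simple p1 p10.
  case/eqP; apply: eq_bigr => a _; rewrite p1E p0E /f; case: eqP => [->|//].
  by rewrite tE lki -tE; congr t; apply: val_inj.
split=> // i; apply/(simple_eigenvalue_prod charA (tE i)) => k ki.
rewrite !tE; apply/eqP => /complexI lki; move: ki; rewrite -val_eqE /=.
by case: ltngtP => // /ldecr; rewrite lki ltxx.
Qed.

Lemma strong_PF_gantmacher_krein :
    (forall j, (0 < j <= n)%N -> strong_PF (compound j A)) ->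
  gantmacher_krein A.
Proof.
move=> PF; have [l [l0 ldecr simple]] := strong_PF_real_spectrum PF.
have eigv i : exists x : 'cV[R]_n, x != 0 /\ A *m x = l i *: x.
  (* [eigenvalue] refers to row vectors, hence the detour through the transpose. *)
  have : eigenvalue A^T (l i).
    rewrite eigenvalue_root_char char_poly_trmx -dvdp_XsubCl.
    by have [] := simple i.
  case/eigenvalueP => x xA x0; exists x^T; split; first by rewrite trmx_eq0.
  by rewrite -[A]trmxK -trmx_mul xA linearZ.
have [x xP] := fin_all_exists eigv.
have X0 i : col i (eigenmx x) != 0 by rewrite col_eigenmx; have [] := xP i.
have Xeig i : A *m col i (eigenmx x) = l i *: col i (eigenmx x).
  by rewrite col_eigenmx; have [] := xP i.
exists l, x; split => //; first by move=> i; have [] := xP i.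
apply: column_sign_markov => [i|j lejn p0 j0 p0E]; first by have [] := xP i.
have jb : (0 < j <= n)%N by rewrite j0.
apply: (@column_sign_of_strong_PF _ _ _ _ _ l0 ldecr X0 Xeig _ jb p0 _ (PF j jb)).
by move=> a; rewrite p0E; apply: val_inj.
Qed.

Lemma compound_minor j k p q :
  (compound j A ^+ k) p q = minor j (A ^+ k) (nth [::] (subsets_lex n j) p)
                                             (nth [::] (subsets_lex n j) q).
Proof. by rewrite -compoundX mxE. Qed.

Lemma ESTP_compound : ESTP A ->
  forall j, (0 < j <= n)%N -> eventually_positive (compound j A).
Proof.
move=> [k0 stp] j jb; exists k0 => k lek p q; rewrite compound_minor.
by apply: stp => //; apply: mem_nth.
Qed.

Lemma compound_ESTP :
    (forall j, (0 < j <= n)%N -> eventually_positive (compound j A)) -> ESTP A.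
Proof.
(* The thresholds depend on j; induction on m takes their maximum over all orders up to m. *)
move=> pos; suff step m : (m <= n)%N -> exists k0, forall j k, (0 < j <= m)%N ->
    (k0 <= k)%N -> forall p q, 0 < (compound j A ^+ k) p q.
  have [k0 k0P] := step n (leqnn n); exists k0 => k lek j jb r c rL cL.
  rewrite -(nth_index [::] rL) -(nth_index [::] cL).
  move: rL cL; rewrite -!index_mem => rL cL.
  by rewrite -(@compound_minor j k (Ordinal rL) (Ordinal cL)) k0P.
elim: m => [|m IHm] lem; first by exists 0%N => -[|j].
have [k0 k0P] := IHm (ltnW lem); have [k1 k1P] := pos m.+1 lem.
exists (maxn k0 k1) => j k /andP[j0]; rewrite geq_max leq_eqVlt ltnS.
case/orP => [/eqP-> /andP[_ lek] p q|lej /andP[lek _] p q]; first exact: k1P.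
by apply: k0P; rewrite ?j0.
Qed.
End RealSpectrum.

Unset Implicit Arguments.

Theorem theorem7 (R : realType) (n : nat) (A : 'M[R]_n) :
  [<-> gantmacher_krein A /\ gantmacher_krein A^T;
       forall j : nat, (1 <= j <= n)%N ->
         strong_PF (compound j A) /\ strong_PF (compound j A)^T;
       forall j : nat, (1 <= j <= n)%N -> eventually_positive (compound j A);
       ESTP A].
Proof.
(* For j <= n a j-subset exists, so the compound has positive size and a Perron root. *)
have size_gt0 j : (0 < j <= n)%N -> (0 < size (subsets_lex n j))%N.
  by case/andP=> _ /first_idx[[p ltp] _]; apply: leq_ltn_trans ltp.
tfae.
- move=> [gkA gkAT] j jb; split; first exact: gantmacher_krein_strong_PF.
  by rewrite -compound_tr; apply: gantmacher_krein_strong_PF.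
- by move=> PF j /PF[]; apply: strong_PF_eventually_positive.
- exact: compound_ESTP.
move=> /ESTP_compound pos; split; apply: strong_PF_gantmacher_krein => j jb.
  exact: eventually_positive_strong_PF (size_gt0 j jb) (pos j jb).
rewrite compound_tr; apply: eventually_positive_strong_PF (size_gt0 j jb) _.
exact/eventually_positive_trmx/pos.
Qed.
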